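(* Let $(g,\nabla)$ be a statistical structure on an $n$-dimensional manifold $M$ and let $r>0$. The mean curvature $H$ of $S^rM$ in $(TM,\tilde g)$ at $\xi\in S^rM$ is given by $$\begin{aligned}H_\xi=\frac{1}{\sqrt{r^2+\|K(\xi,\xi)\|^2}}\Big\{&-(n-1)-\tau(K(\xi,\xi))+\frac{\|K(\xi,\xi)\|^2}{r^2}\\&+\operatorname{tr}(\nabla^g_{\cdot}K)(\xi,\xi)-\frac{1}{r^2+\|K(\xi,\xi)\|^2}\,g\big((\nabla^g_{K(\xi,\xi)}K)(\xi,\xi),K(\xi,\xi)\big)\\&-2\operatorname{tr}K_\xi^2+2\,\frac{\|K(\xi,K(\xi,\xi))\|^2}{r^2+\|K(\xi,\xi)\|^2}\\&+\frac{1}{r^2+\|K(\xi,\xi)\|^2}\|K(\xi,\xi)\|^2\Big(1-\frac1{r^2}\|K(\xi,\xi)\|^2\Big)\Big\}.\end{aligned}$$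
   Context: All objects are smooth. A statistical structure on a manifold $M$ is a pair $(g,\nabla)$, where $g$ is a (positive definite) Riemannian metric and $\nabla$ is a torsion-free affine connection such that $(\nabla_Xg)(Y,Z)=(\nabla_Yg)(X,Z)$ for all $X,Y,Z$. $\nabla^g$ is the Levi-Civita connection of $g$, $K(X,Y)=K_XY=\nabla_XY-\nabla^g_XY$, $\tau(X)=\operatorname{tr}K_X$, $\|\cdot\|$ is the norm of $g$, and $\operatorname{tr}(\nabla^g_{\cdot}K)(\xi,\xi)$ is the trace of the endomorphism $X\mapsto(\nabla^g_XK)(\xi,\xi)$. Let $\pi:TM\to M$ be the tangent bundle. For $\xi,X\in T_pM$: the vertical lift $X^v_\xi\in T_\xi TM$ is the velocity at $t=0$ of the curve $t\mapsto \xi+tX$; the horizontal lift $X^h_\xi\in T_\xi TM$ is the velocity at $t=0$ of the curve $t\mapsto\xi_t$ obtained by $\nabla$-parallel transport of $\xi$ along the $\nabla$-geodesic with initial velocity $X$. One has $T_\xi TM=\{X^v_\xi\}\oplus\{X^h_\xi\}$. The Sasakian metric $\tilde g$ on $TM$ is given by $\tilde g(X^v,Y^v)=g(X,Y)=\tilde g(X^h,Y^h)$, $\tilde g(X^v,Y^h)=0$; $\nabla^{\tilde g}$ is its Levi-Civita connection. $S^rM=\{\xi\in TM: g(\xi,\xi)=r^2\}$ is a hypersurface of $(TM,\tilde g)$ with the induced metric and unit normal $\mathcal N_\xi=\frac{1}{\sqrt{r^2+\|K(\xi,\xi)\|^2}}(\xi^v_\xi-K(\xi,\xi)^h_\xi)$.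 Its second fundamental form is $\mathfrak h(A,B)=\tilde g(\nabla^{\tilde g}_AB,\mathcal N)$ and its mean curvature $H$ is the (unnormalized) trace of $\mathfrak h$ with respect to the induced metric. *)

(* Defs.v *)
From mathcomp Require Import all_boot all_order all_algebra.
From mathcomp Require Import all_classical all_reals all_analysis.

Set Implicit Arguments.
Unset Strict Implicit.
Unset Printing Implicit Defensive.

Import Order.TTheory GRing.Theory Num.Theory.
Import numFieldNormedType.Exports.
Local Open Scope classical_set_scope.
Local Open Scope ring_scope.

(* [smooth_on U f], for U open: f is C^oo on U.  Demanding Frechet
   differentiability at every stage makes continuity of the derivatives
   automatic. *)
Section Smooth.
Context {R : realType} {V W : normedModType R}.

Fixpoint Ck_on (k : nat) (U : set V) (f : V -> W) : Prop :=
  if k is k'.+1 then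
    (forall x, U x -> differentiable f x) /\
    (forall v, Ck_on k' U ('D_v f))
  else forall x, U x -> {for x, continuous f}.

Definition smooth_on (U : set V) (f : V -> W) : Prop :=
  forall k, Ck_on k U f.

End Smooth.

(* A manifold is given, as in do Carmo's textbook, by a set of points and a
   family of injective parametrizations [chart_par i : chart_dom i -> pt] with
   inverses [chart_coord i]; the topology is the one they induce.  The points
   of the manifold are those covered by some chart ([carrier]); [pt] may be
   larger.  The atlas need not be maximal, and [chart_par i], [chart_coord i]
   are only meaningful on [chart_dom i], [chart_image i]. *)
Record atlas (R : realType) (n : nat) := Atlas {
  pt : Type;
  chart : Type;
  chart_dom : chart -> set 'rV[R]_n;
  chart_par : chart -> 'rV[R]_n -> pt;
  chart_coord : chart -> pt -> 'rV[R]_n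
}.

Section Manifold.
Context {R : realType} {n : nat} (A : atlas R n).

Definition chart_image (i : chart A) : set (pt A) := chart_par i @` chart_dom i.

Definition carrier : set (pt A) := \bigcup_i chart_image i.

Definition overlap (i j : chart A) : set 'rV[R]_n :=
  [set x | chart_dom i x /\ chart_image j (chart_par i x)].

Definition transition (i j : chart A) (x : 'rV[R]_n) : 'rV[R]_n :=
  chart_coord j (chart_par i x).

Definition mopen (W : set (pt A)) : Prop :=
  W `<=` carrier /\
  forall i : chart A,
    open [set x : 'rV[R]_n | chart_dom i x /\ W (chart_par i x)].

Definition hausdorff_atlas : Prop :=
  forall p q, carrier p -> carrier q -> p <> q ->
  exists U V, [/\ mopen U, mopen V, U p, V q & U `&` V = set0].

Definition second_countable_atlas : Prop :=
  exists B : set (set (pt A)),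
    [/\ countable B, forall b, B b -> mopen b &
        forall W p, mopen W -> W p ->
          exists b, [/\ B b, b p & b `<=` W]].

Definition is_manifold : Prop :=
  [/\ forall i : chart A, open (chart_dom i),
      forall (i : chart A) x, chart_dom i x ->
        chart_coord i (chart_par i x) = x,
      forall i j,
        open (overlap i j) /\ smooth_on (overlap i j) (transition i j),
      hausdorff_atlas &
      second_countable_atlas].

End Manifold.

(* In a chart, a field of bilinear forms is a matrix-valued function, and a
   connection is given by its Christoffel symbols: [(G x k) a b] is
   Gamma^k_(a b) at x, so that [christoffel G x v w] is the vector with
   components Gamma^k_(a b)(x) v^a w^b.  Tangent vectors at x are row
   vectors of components. *)
Section ChartCalculus.
Context {R : realType} {n : nat}.
Notation vec := 'rV[R]_n.
Implicit Types (g : vec -> 'M[R]_n) (G Gg : vec -> 'I_n -> 'M[R]_n).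
Implicit Types (x u v w : vec).

Definition ip g x v w : R := (v *m g x *m w^T) 0 0.

Definition metric_norm g x v : R := Num.sqrt (ip g x v v).

Definition christoffel G x v w : vec :=
  \row_k (v *m G x k *m w^T) 0 0.

Definition cov_deriv G v (Y : vec -> vec) x : vec :=
  'D_v Y x + christoffel G x v (Y x).

Definition cov_along G (c : R -> vec) (Y : R -> vec) (t : R) : vec :=
  derive1 Y t + christoffel G (c t) (derive1 c t) (Y t).

(* (nabla_u g)(v, w): the vectors v, w are extended to fields that are
   constant in the chart, which is harmless by tensoriality; similarly for
   [nabla_tensor] below. *)
Definition nabla_metric G g x u v w : R :=
  'D_u (fun y => ip g y v w) x
  - ip g x (cov_deriv G u (cst v) x) w
  - ip g x v (cov_deriv G u (cst w) x).

Definition torsion_free G x : Prop :=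
  forall v w, christoffel G x v w = christoffel G x w v.

Definition difference_tensor G Gg x v w : vec :=
  christoffel G x v w - christoffel Gg x v w.

(* (nabla_u T)(v, w) for a (1,2)-tensor field T. *)
Definition nabla_tensor G (T : vec -> vec -> vec -> vec) x u v w : vec :=
  cov_deriv G u (fun y => T y v w) x
  - T x (cov_deriv G u (cst v) x) w
  - T x v (cov_deriv G u (cst w) x).

Definition endo_tr (f : vec -> vec) : R := \tr (lin1_mx f).

End ChartCalculus.

(* Global objects: families of local expressions, one for each chart, subject
   to the classical transformation laws. *)
Section Structures.
Context {R : realType} {n : nat} (A : atlas R n).

Definition metric_data := chart A -> 'rV[R]_n -> 'M[R]_n.

Definition connection_data := chart A -> 'rV[R]_n -> 'I_n -> 'M[R]_n.

Definition is_metric (g : metric_data) : Prop :=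
  [/\ forall i, smooth_on (chart_dom i) (g i),
      forall i x, chart_dom i x -> (g i x)^T = g i x,
      forall i x v, chart_dom i x -> v != 0 -> 0 < ip (g i) x v v &
      forall i j x v w, overlap i j x ->
        ip (g i) x v w =
        ip (g j) (transition i j x)
          ('D_v (transition i j) x) ('D_w (transition i j) x)].

(* The second condition says that nabla_v Y does not depend on the chart. *)
Definition is_connection (G : connection_data) : Prop :=
  (forall i k, smooth_on (chart_dom i) (fun x => G i x k)) /\
  (forall i j x v w, overlap i j x ->
     'D_(christoffel (G i) x v w) (transition i j) x =
     'D_v ('D_w (transition i j)) x +
     christoffel (G j) (transition i j x)
       ('D_v (transition i j) x) ('D_w (transition i j) x)).

Definition statistical_structure (g : metric_data) (G : connection_data) :
    Prop :=
  [/\ is_metric g, is_connection G,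
      forall i x, chart_dom i x -> torsion_free (G i) x &
      forall i x u v w, chart_dom i x ->
        nabla_metric (G i) (g i) x u v w = nabla_metric (G i) (g i) x v u w].

Definition levi_civita (g : metric_data) (G : connection_data) : Prop :=
  [/\ is_connection G,
      forall i x, chart_dom i x -> torsion_free (G i) x &
      forall i x u v w, chart_dom i x -> nabla_metric (G i) (g i) x u v w = 0].

End Structures.

(* The tangent bundle, of dimension n + n.  A tangent vector is a base point
   together with its components in every chart around that point (and 0 in
   the other charts).  In the chart of TM induced by the chart i of M, the
   vector at [chart_par i x] with components v has coordinates
   [row_mx x v]. *)
Section TangentBundle.
Context {R : realType} {n : nat} (M : atlas R n).

Definition TM : atlas R (n + n) := {|
  pt := (pt M * (chart M -> 'rV[R]_n))%type;
  chart := chart M;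
  chart_dom := fun i => [set z | chart_dom i (lsubmx z)];
  chart_par := fun i z =>
    (chart_par i (lsubmx z),
     fun j => if `[< chart_image j (chart_par i (lsubmx z)) >]
              then 'D_(rsubmx z) (transition i j) (lsubmx z) else 0);
  chart_coord := fun j q => row_mx (chart_coord j q.1) (q.2 j) |}.

Definition vlift (x v u : 'rV[R]_n) : 'rV[R]_(n + n) :=
  derive1 (fun t : R => row_mx x (v + t *: u)) 0.

(* a is the velocity at t = 0 of a curve t |-> (c t, xi t) in TM, where c is a
   geodesic with c 0 = x, c'(0) = u, and xi is parallel along c with
   xi 0 = v. *)
Definition is_hlift (G : connection_data M) (i : chart M)
    (x v u : 'rV[R]_n) (a : 'rV[R]_(n + n)) : Prop :=
  exists c xi : R -> 'rV[R]_n,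
    [/\ c 0 = x, derive1 c 0 = u, xi 0 = v,
        \forall t \near (0 : R),
          [/\ chart_dom i (c t), derivable c t 1, derivable (derive1 c) t 1,
              derivable xi t 1 &
              cov_along (G i) c (derive1 c) t = 0 /\
              cov_along (G i) c xi t = 0] &
        a = derive1 (fun t : R => row_mx (c t) (xi t)) 0].

(* The horizontal lift is unique by definition and exists by the
   Picard-Lindelof theorem. *)
Definition hlift (G : connection_data M) (i : chart M)
    (x v u : 'rV[R]_n) : 'rV[R]_(n + n) :=
  xget 0 [set a | is_hlift G i x v u a].

Definition is_sasakian (g : metric_data M) (G : connection_data M)
    (gt : metric_data TM) : Prop :=
  is_metric gt /\
  forall (i : chart M) (x v u w : 'rV[R]_n), chart_dom i x ->
    [/\ ip (gt i) (row_mx x v) (vlift x v u) (vlift x v w) = ip (g i) x u w,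
        ip (gt i) (row_mx x v) (hlift G i x v u) (hlift G i x v w)
          = ip (g i) x u w &
        ip (gt i) (row_mx x v) (vlift x v u) (hlift G i x v w) = 0].

Definition sphere_bundle (g : metric_data M) (r : R) : set (pt TM) :=
  [set q | exists (i : chart M) (x v : 'rV[R]_n),
     [/\ chart_dom i x, ip (g i) x v v = r ^+ 2 &
         q = @chart_par _ _ TM i (row_mx x v)]].

Definition sphere_normal (g : metric_data M) (G Gg : connection_data M)
    (r : R) (i : chart M) (x v : 'rV[R]_n) : 'rV[R]_(n + n) :=
  let Kvv := difference_tensor (G i) (Gg i) x v v in
  (Num.sqrt (r ^+ 2 + metric_norm (g i) x Kvv ^+ 2))^-1 *:
    (vlift x v v - hlift G i x v Kvv).

End TangentBundle.

(* Extrinsic geometry of a hypersurface S of the manifold A with metric g and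
   connection G, at the point with coordinates z in the chart i; N is the
   chosen unit normal at this point. *)
Section Hypersurface.
Context {R : realType} {m : nat} (A : atlas R m).
Variables (g : metric_data A) (G : connection_data A) (S : set (pt A)).

Definition tangent_space (i : chart A) (z : 'rV[R]_m) : set 'rV[R]_m :=
  [set w | exists c : R -> 'rV[R]_m,
     [/\ c 0 = z, derivable c 0 1, derive1 c 0 = w &
         \forall t \near (0 : R), chart_dom i (c t) /\ S (chart_par i (c t))]].

Definition tangent_extension (i : chart A) (z b : 'rV[R]_m)
    (Y : 'rV[R]_m -> 'rV[R]_m) : Prop :=
  Y z = b /\
  exists O : set 'rV[R]_m,
    [/\ open O, O z, O `<=` chart_dom i, smooth_on O Y &
        forall y, O y -> S (chart_par i y) -> tangent_space i y (Y y)].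

(* The value g(nabla_a Y, N) does not depend on the extension Y of b. *)
Definition second_form (i : chart A) (z N a b : 'rV[R]_m) : R :=
  xget 0 [set s | exists Y, tangent_extension i z b Y /\
                            s = ip (g i) z (cov_deriv (G i) a Y z) N].

Definition orthonormal_basis (i : chart A) (z : 'rV[R]_m) (k : nat)
    (e : 'I_k -> 'rV[R]_m) : Prop :=
  (forall a b, ip (g i) z (e a) (e b) = (a == b)%:R) /\
  tangent_space i z =
    [set w | exists t : 'I_k -> R, w = \sum_a t a *: e a].

(* The trace of the second fundamental form with respect to the induced
   metric; it does not depend on the orthonormal basis. *)
Definition mean_curvature (i : chart A) (z N : 'rV[R]_m) : R :=
  xget 0 [set H | exists k (e : 'I_k -> 'rV[R]_m),
                    orthonormal_basis i z e /\
                    H = \sum_a second_form i z N (e a) (e a)].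

End Hypersurface.

(* Main.v *)
From HB Require Import structures.
Require Import Defs.
From mathcomp Require Import all_boot all_order all_algebra.
From mathcomp Require Import all_classical all_reals all_analysis.
From mathcomp Require Import ring lra.
Import Order.TTheory GRing.Theory Num.Theory.
Import numFieldNormedType.Exports.
Local Open Scope classical_set_scope.
Local Open Scope ring_scope.
Set Implicit Arguments.
Unset Strict Implicit.

(** The sphere bundle is the level set [F = r^2] of the square norm
    [F (xi) = g (xi, xi)] on the tangent bundle. Its mean curvature is therefore
    determined by the gradient [V] of [F] for the Sasakian metric [gt]: with [D]
    the Levi-Civita connection of [gt],

      [H = - |V|^-1 (tr (D V) - |V|^-2 gt (D_V V, V))]

    ([mean_curvature_level]). The second fundamental form is minus the Hessian of
    [F] divided by [|V|], because differentiating [gt (V, Y) = 0] along the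
    hypersurface turns [gt (D_a Y, V)] into [- gt (D_a V, Y)]; and the trace
    over the tangent space is the full trace minus the normal term.

    Write [k = K (xi, xi)]. From [nabla g = - 2 g (K (., .), .)] and the total
    symmetry of [g (K (., .), .)] one finds [V = 2 (xi^v - k^h)] ([gradientE]), so
    [|V|^2 = 4 (g (xi, xi) + |k|^2)] ([gradient_sqnorm]). This leaves two
    computations.

    - The full trace [tr (D V)] is the divergence of [V] ([trace_shape]). The
      only information about the connection of the Sasakian metric that it needs
      is the trace of the endomorphism [D_w] on constant fields, and this is
      twice the corresponding trace downstairs ([trace_sasaki_connection]), since
      in suitable frames the Sasakian metric is two copies of [g].
    - The normal term is [2 gt (D_V V, V) = V (|V|^2)] ([shape_normal]), a
      derivative of the explicit function [|V|^2].

    Two facts make the level set description available at every point of the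
    sphere bundle: its tangent space is the kernel of [dF] ([tangent_sphere]), and
    tangent vectors extend to smooth tangent fields
    ([tangent_extension_sphere]). Both rest on the homogeneity of [F] along the
    fibres. *)

(** * Directional derivatives and forms with variable coefficients *)

Section DirectionalDerivatives.
Context {R : realType} {V : normedModType R}.

Lemma is_derive_mxP {m n} (A : V -> 'M[R]_(m, n)) (x v : V) (dA : 'M[R]_(m, n)) :
  is_derive x v A dA <->
  forall i j, is_derive x v (fun y => A y i j) (dA i j).
Proof.
split=> [[Ax <-] i j|dAij].
  by apply: DeriveDef; [move/derivable_mxP : Ax; exact | rewrite derive_mx// mxE].
have Ax : derivable A x v by apply/derivable_mxP => i j; exact: ex_derive.
apply: DeriveDef => //; rewrite derive_mx//.
by apply/matrixP => i j; rewrite mxE; exact: derive_val.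
Qed.

Lemma is_derive_mulmx {m n p} (A : V -> 'M[R]_(m, n)) (B : V -> 'M[R]_(n, p))
    (x v : V) dA dB :
  is_derive x v A dA -> is_derive x v B dB ->
  is_derive x v (fun y => A y *m B y) (dA *m B x + A x *m dB).
Proof.
move=> /is_derive_mxP Ax /is_derive_mxP Bx; apply/is_derive_mxP => i j.
rewrite [X in is_derive _ _ X _](_ : _ =
  \sum_(k < n) (fun y => A y i k * B y k j)); last first.
  by apply/funext => y; rewrite mxE fct_sumE.
have H : is_derive x v (\sum_(k < n) (fun y => A y i k * B y k j))
    (\sum_(k < n) (A x i k * dB k j + B x k j * dA i k)).
  by apply: is_derive_sum => k; exact: is_deriveM.
apply: (is_derive_eq H); rewrite !mxE -big_split; apply: eq_bigr => k _ /=.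
by rewrite addrC [B x k j * _]mulrC.
Qed.

Lemma is_derive_trmx {m n} (A : V -> 'M[R]_(m, n)) (x v : V) dA :
  is_derive x v A dA -> is_derive x v (fun y => (A y)^T) dA^T.
Proof.
move=> /is_derive_mxP Ax; apply/is_derive_mxP => i j.
by under eq_fun do rewrite mxE; rewrite mxE; exact: Ax.
Qed.

(** A linear map sends lines to lines, so the two difference quotients agree. With
    the block projections this differentiates every field pulled back from the
    base of the tangent bundle. *)
Lemma is_derive_complin {U : normedModType R} {W : normedModType R}
    (l : {linear V -> U}) (f : U -> W) (x v : V) df :
  is_derive (l x) (l v) f df -> is_derive x v (fun y => f (l y)) df.
Proof.
have E : (fun h : R => h^-1 *: (((fun y => f (l y)) \o shift x) (h *: v) - f (l x)))
   = (fun h => h^-1 *: ((f \o shift (l x)) (h *: l v) - f (l x))).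
  by apply/funext => h /=; congr (_ *: (f _ - _)); exact: linearP.
by move=> [dv <-]; apply: DeriveDef; rewrite /derivable /derive E.
Qed.

Lemma is_derive_linear {U : normedModType R} (l : {linear V -> U}) (x v : V) :
  is_derive x v l (l v).
Proof. by apply: (@is_derive_complin _ _ l id); exact: is_derive_id. Qed.

End DirectionalDerivatives.

Section ConnectionCoefficients.
Context {R : realType} {n : nat}.
Implicit Types (v w : 'rV[R]_n).

(** Up to conversion, [ip g x] is [bform (g x)] and [christoffel G x] is
    [bmap (G x)]. Separating the matrix from the point at which it is taken lets
    the Leibniz rule treat the coefficients as a third factor. *)
Definition bform (A : 'M[R]_n) v w : R := (v *m A *m w^T) 0 0.

Definition bmap (G : 'I_n -> 'M[R]_n) v w : 'rV[R]_n := \row_k bform (G k) v w.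

Lemma is_derive_bform {V : normedModType R} (A : V -> 'M[R]_n)
    (u w : V -> 'rV[R]_n) (x v : V) dA du dw :
  is_derive x v A dA -> is_derive x v u du -> is_derive x v w dw ->
  is_derive x v (fun y => bform (A y) (u y) (w y))
    (bform dA (u x) (w x) + bform (A x) du (w x) + bform (A x) (u x) dw).
Proof.
move=> Ax ux wx.
have := is_derive_mulmx (is_derive_mulmx ux Ax) (is_derive_trmx wx).
move=> /is_derive_mxP /(_ 0 0) H.
have mx11D (B C : 'M[R]_1) : (B + C) 0 0 = B 0 0 + C 0 0 by rewrite mxE.
apply: (is_derive_eq H); rewrite /bform !mulmxDl !mx11D.
by rewrite [X in X + _]addrC.
Qed.

Lemma is_derive_bmap {V : normedModType R} (G : V -> 'I_n -> 'M[R]_n)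
    (u w : V -> 'rV[R]_n) (x v : V) (dG : 'I_n -> 'M[R]_n) du dw :
  (forall k, is_derive x v (fun y => G y k) (dG k)) ->
  is_derive x v u du -> is_derive x v w dw ->
  is_derive x v (fun y => bmap (G y) (u y) (w y))
    (bmap dG (u x) (w x) + bmap (G x) du (w x) + bmap (G x) (u x) dw).
Proof.
move=> Gx ux wx; apply/is_derive_mxP => i j.
under eq_fun do rewrite mxE; rewrite !mxE.
exact: is_derive_bform.
Qed.

Lemma bformDl A v v' w : bform A (v + v') w = bform A v w + bform A v' w.
Proof. by rewrite /bform !mulmxDl mxE. Qed.

Lemma bformZl A c v w : bform A (c *: v) w = c * bform A v w.
Proof. by rewrite /bform -!scalemxAl mxE. Qed.

Lemma bformDr A v w w' : bform A v (w + w') = bform A v w + bform A v w'.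
Proof. by rewrite /bform linearD mulmxDr mxE. Qed.

Lemma bformZr A c v w : bform A v (c *: w) = c * bform A v w.
Proof. by rewrite /bform linearZ /= -scalemxAr mxE. Qed.

Lemma bformNl A v w : bform A (- v) w = - bform A v w.
Proof. by rewrite -scaleN1r bformZl mulN1r. Qed.

Lemma bformNr A v w : bform A v (- w) = - bform A v w.
Proof. by rewrite -scaleN1r bformZr mulN1r. Qed.

Lemma bform0l A w : bform A 0 w = 0.
Proof. by rewrite /bform !mul0mx mxE. Qed.

Lemma bform0r A v : bform A v 0 = 0.
Proof. by rewrite /bform trmx0 mulmx0 mxE. Qed.

Definition bformE :=
  (bformDl, bformDr, bformNl, bformNr, bformZl, bformZr, bform0l, bform0r).

Lemma bformDm A B v w : bform (A + B) v w = bform A v w + bform B v w.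
Proof. by rewrite /bform mulmxDr mulmxDl mxE. Qed.

Lemma bform_delta (A : 'M[R]_n) i j : A i j = bform A (delta_mx 0 i) (delta_mx 0 j).
Proof. by rewrite /bform trmx_delta -rowE -colE !mxE. Qed.

Lemma bform_sym A v w : A^T = A -> bform A v w = bform A w v.
Proof.
move=> As; rewrite /bform -[in LHS]mulmxA -[X in (v *m X) 0 0]trmxK.
by rewrite trmx_mul trmxK As -[in LHS](trmxK v) -trmx_mul mxE.
Qed.

Lemma bmapDl G v v' w : bmap G (v + v') w = bmap G v w + bmap G v' w.
Proof. by apply/rowP => k; rewrite !mxE bformDl. Qed.

Lemma bmapDr G v w w' : bmap G v (w + w') = bmap G v w + bmap G v w'.
Proof. by apply/rowP => k; rewrite !mxE bformDr. Qed.

Lemma bmapZl G c v w : bmap G (c *: v) w = c *: bmap G v w.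
Proof. by apply/rowP => k; rewrite !mxE bformZl. Qed.

Lemma bmapZr G c v w : bmap G v (c *: w) = c *: bmap G v w.
Proof. by apply/rowP => k; rewrite !mxE bformZr. Qed.

Lemma bmapNl G v w : bmap G (- v) w = - bmap G v w.
Proof. by rewrite -scaleN1r bmapZl scaleN1r. Qed.

Lemma bmapNr G v w : bmap G v (- w) = - bmap G v w.
Proof. by rewrite -scaleN1r bmapZr scaleN1r. Qed.

Lemma bmap0l G w : bmap G 0 w = 0.
Proof. by apply/rowP => k; rewrite !mxE bform0l. Qed.

Lemma bmap0r G v : bmap G v 0 = 0.
Proof. by apply/rowP => k; rewrite !mxE bform0r. Qed.

Definition bmapE := (bmapDl, bmapDr, bmapNl, bmapNr, bmapZl, bmapZr, bmap0l, bmap0r).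

End ConnectionCoefficients.

(** * Closure properties of [Ck_on] *)

Section SmoothClosure.
Context {R : realType} {V : normedModType R}.

Lemma near_eq_differentiable {W : normedModType R} (f h : V -> W) (x : V) :
  {near x, f =1 h} -> differentiable f x -> differentiable h x.
Proof.
move=> fh /diff_locallyP[cdf /eqaddoP df].
have fhx : f x = h x := nbhs_singleton fh.
have E : h \o shift x = cst (h x) + 'd f x +o_ 0 id.
  apply/eqaddoP => e e0; have := df e e0.
  have fh0 : \forall y \near 0, f (y + x) = h (y + x).
    by move: fh; rewrite (near_shift 0) /= subr0.
  by apply: filterS2 fh0 => y /= fhy; rewrite /= !fctE /= fhy fhx.
have dh := diff_unique cdf E.
by apply/diff_locallyP; rewrite dh.
Qed.

Section OpenSet.
Variable U : set V.
Hypothesis oU : open U.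

Let near_eq {T} (f h : V -> T) x :
  (forall y, U y -> f y = h y) -> U x -> {near x, f =1 h}.
Proof.
by move=> fh Ux; apply: filterS (open_nbhs_nbhs (conj oU Ux)) => y; exact: fh.
Qed.

(** The Leibniz formulas for derivatives hold on [U] only, so the inductions on
    [k] below must be insensitive to values outside [U]. *)
Lemma Ck_on_eq {W : normedModType R} k (f h : V -> W) :
  (forall x, U x -> f x = h x) -> Ck_on k U f -> Ck_on k U h.
Proof.
elim: k f h => [|k IH] f h fh /=.
  move=> cf x Ux; have := cf x Ux; rewrite /prop_for /continuous_at -(fh x Ux).
  by apply: cvg_trans; apply: near_eq_cvg; exact: near_eq.
move=> [df Df]; split=> [x Ux|v].
  by apply: near_eq_differentiable (df x Ux); exact: near_eq.
by apply: IH (Df v) => x Ux; apply: near_eq_derive; exact: near_eq.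
Qed.

Lemma Ck_on_cst {W : normedModType R} k (w : W) : Ck_on k U (cst w).
Proof.
elim: k w => [|k IH] w /=; first by move=> x _; exact: cst_continuous.
split=> [x _|v]; first exact: differentiable_cst.
rewrite [X in Ck_on _ _ X](_ : _ = cst 0) //.
by apply/funext => x; exact: derive_cst.
Qed.

Lemma Ck_on_prev {W : normedModType R} k (f : V -> W) : Ck_on k.+1 U f -> Ck_on k U f.
Proof.
elim: k f => [|k IH] f [df Df]; first by move=> x Ux; exact/differentiable_continuous/df.
by split=> // v; exact/IH/Df.
Qed.

Lemma Ck_on_differentiable {W : normedModType R} (f : V -> W) x :
  Ck_on 1 U f -> U x -> differentiable f x.
Proof. by move=> [df _]; exact: df. Qed.

Lemma Ck_on_derive {W : normedModType R} k (f : V -> W) v :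
  Ck_on k.+1 U f -> Ck_on k U ('D_v f).
Proof. by move=> [_ Df]; exact: Df. Qed.

Lemma Ck_onD {W : normedModType R} k (f h : V -> W) :
  Ck_on k U f -> Ck_on k U h -> Ck_on k U (fun y => f y + h y).
Proof.
elim: k f h => [|k IH] f h /=.
  by move=> cf ch x Ux; apply: cvgD; [exact: cf | exact: ch].
move=> [df Df] [dh Dh]; split=> [x Ux|v].
  by apply: differentiableD; [exact: df | exact: dh].
apply: Ck_on_eq (IH _ _ (Df v) (Dh v)) => x Ux.
by rewrite [RHS]deriveD //; apply: diff_derivable; [exact: df | exact: dh].
Qed.

Lemma Ck_onM k (f h : V -> R) :
  Ck_on k U f -> Ck_on k U h -> Ck_on k U (fun y => f y * h y).
Proof.
elim: k f h => [|k IH] f h.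
  by move=> cf ch x Ux; apply: cvgM; [exact: cf | exact: ch].
move=> fk hk; have fk' := Ck_on_prev fk; have hk' := Ck_on_prev hk.
have [df Df] := fk; have [dh Dh] := hk; split=> [x Ux|v].
  by apply: differentiableM; [exact: df | exact: dh].
apply: Ck_on_eq (Ck_onD (IH _ _ fk' (Dh v)) (IH _ _ hk' (Df v))) => x Ux.
by rewrite [RHS]deriveM //; apply: diff_derivable; [exact: df | exact: dh].
Qed.

Lemma Ck_onZl {W : normedModType R} k (f : V -> R) (w : W) :
  Ck_on k U f -> Ck_on k U (fun y => f y *: w).
Proof.
elim: k f => [|k IH] f /=.
  by move=> cf x Ux; apply: cvgZl; exact: cf.
move=> [df Df]; split=> [x Ux|v]; first exact/differentiableZl/df.
apply: Ck_on_eq (IH _ (Df v)) => x Ux.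
rewrite [RHS]deriveE; last exact/differentiableZl/df.
by rewrite diffZl ?deriveE//; exact: df.
Qed.

Lemma Ck_on_sum {W : normedModType R} k (I : Type) (s : seq I) (f : I -> V -> W) :
  (forall i, Ck_on k U (f i)) -> Ck_on k U (fun y => \sum_(i <- s) f i y).
Proof.
move=> fk; elim: s => [|i s IH].
  by under eq_fun do rewrite big_nil; exact: Ck_on_cst.
by under eq_fun do rewrite big_cons; exact: Ck_onD.
Qed.

Lemma Ck_on_mx {m n} k (A : V -> 'M[R]_(m, n)) :
  (forall i j, Ck_on k U (fun y => A y i j)) -> Ck_on k U A.
Proof.
move=> Ak; rewrite (funext (fun y => matrix_sum_delta (A y))).
by do 2!(apply: Ck_on_sum => ?); exact: Ck_onZl.
Qed.

Lemma Ck_on_entry {m n} k (A : V -> 'M[R]_(m, n)) i j :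
  Ck_on k U A -> Ck_on k U (fun y => A y i j).
Proof.
elim: k A => [|k IH] A.
  move=> cA x Ux; apply: (@continuous_comp _ _ _ A (fun B : 'M[R]_(m, n) => B i j)).
    exact: cA.
  exact: coord_continuous.
move=> [dA DA]; split=> [x Ux|v].
  by apply: (@differentiable_comp _ _ _ _ A (fun B : 'M[R]_(m, n) => B i j));
    [exact: dA | exact: differentiable_coord].
apply: Ck_on_eq (IH _ (DA v)) => x Ux.
by rewrite derive_mx ?mxE//; exact/diff_derivable/dA.
Qed.

End OpenSet.

Lemma Ck_on_complin {U W : normedModType R} (O : set U) (l : {linear V -> U})
    (f : U -> W) k :
  (forall y, differentiable l y) ->
  Ck_on k O f -> Ck_on k (l @^-1` O) (fun y => f (l y)).
Proof.
move=> dl; elim: k f => [|k IH] f.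
  move=> cf x Ox; apply: (@continuous_comp _ _ _ l f); last exact: cf.
  exact/differentiable_continuous/dl.
move=> [df Df]; split=> [x Ox|v].
  by apply: (@differentiable_comp _ _ _ _ l f); [exact: dl | exact: df].
suff -> : 'D_v (fun y => f (l y)) = (fun y => 'D_(l v) f (l y)).
  exact: (IH _ (Df (l v))).
apply/funext => y; rewrite /derive.
suff -> : (fun h : R => h^-1 *: (((fun y => f (l y)) \o shift y) (h *: v) - f (l y)))
   = (fun h => h^-1 *: ((f \o shift (l y)) (h *: l v) - f (l y))) by [].
by apply/funext => h /=; congr (_ *: (f _ - _)); exact: linearP.
Qed.

End SmoothClosure.

Section SmoothForms.
Context {R : realType} {V : normedModType R} {n : nat} (U : set V).
Hypothesis oU : open U.

Lemma Ck_on_bform k (A : V -> 'M[R]_n) (u w : V -> 'rV[R]_n) :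
  Ck_on k U A -> Ck_on k U u -> Ck_on k U w ->
  Ck_on k U (fun y => bform (A y) (u y) (w y)).
Proof.
move=> kA ku kw.
rewrite (_ : (fun y => _) =
    (fun y => \sum_j (\sum_l u y 0 l * A y l j) * w y 0 j)); last first.
  by apply/funext => y; rewrite /bform mxE; apply: eq_bigr => j _; rewrite !mxE.
apply: Ck_on_sum => // j; apply: Ck_onM => //; last exact: Ck_on_entry.
by apply: Ck_on_sum => // l; apply: Ck_onM => //; exact: Ck_on_entry.
Qed.

Lemma Ck_on_bmap k (G : V -> 'I_n -> 'M[R]_n) (u w : V -> 'rV[R]_n) :
  (forall l, Ck_on k U (fun y => G y l)) -> Ck_on k U u -> Ck_on k U w ->
  Ck_on k U (fun y => bmap (G y) (u y) (w y)).
Proof.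
move=> kG ku kw; apply: Ck_on_mx => // i j.
by under eq_fun do rewrite mxE; exact: Ck_on_bform.
Qed.

Lemma Ck_on_linear {W : normedModType R} k (l : {linear V -> W}) :
  (forall y, differentiable l y) -> Ck_on k U l.
Proof.
move=> dl; case: k => [|k] /=; first by move=> y _; exact: differentiable_continuous.
split=> [//|v]; rewrite (_ : 'D_v l = cst (l v)); first exact: Ck_on_cst.
by apply/funext => y; have [_ ->] := is_derive_linear l y v.
Qed.

End SmoothForms.

Section RowBlocks.
Context {R : realType} {V : normedModType R} {m n : nat}.

Lemma is_derive_row_mx (u : V -> 'rV[R]_m) (w : V -> 'rV[R]_n) x v du dw :
  is_derive x v u du -> is_derive x v w dw ->
  is_derive x v (fun y => row_mx (u y) (w y)) (row_mx du dw).
Proof.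
move=> /is_derive_mxP ux /is_derive_mxP wx; apply/is_derive_mxP => i j.
under eq_fun do rewrite mxE; rewrite mxE.
by case: (fintype.split j).
Qed.

Lemma is_derive_scale (f : V -> R) (u : V -> 'rV[R]_m) x v df du :
  is_derive x v f df -> is_derive x v u du ->
  is_derive x v (fun y => f y *: u y) (df *: u x + f x *: du).
Proof.
move=> fx /is_derive_mxP ux; apply/is_derive_mxP => i j.
under eq_fun do rewrite mxE; rewrite !mxE.
by apply: (is_derive_eq (is_deriveM fx (ux i j))); rewrite addrC [df * _]mulrC.
Qed.

Lemma Ck_on_row_mx (U : set V) (oU : open U) k (u : V -> 'rV[R]_m) (w : V -> 'rV[R]_n) :
  Ck_on k U u -> Ck_on k U w -> Ck_on k U (fun y => row_mx (u y) (w y)).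
Proof.
move=> ku kw; apply: Ck_on_mx => // i j; under eq_fun do rewrite mxE.
by case: (fintype.split j) => l; exact: Ck_on_entry.
Qed.

End RowBlocks.

Lemma is_derive_line {R : realType} {m : nat} (y w : 'rV[R]_m) :
  is_derive (0 : R) 1 (fun t => y + t *: w) w.
Proof.
apply: (is_derive_eq (is_deriveD (is_derive_cst y _ _)
  (is_derive_scale (is_derive_id _ _) (is_derive_cst w _ _)))).
by rewrite add0r scale1r scaler0 addr0.
Qed.

Local Opaque Ck_on.

(** * Traces and orthonormal bases *)

Section LinearAlgebra.
Context {R : realType}.

Lemma mul_lin1_mx m p (f : 'rV[R]_m -> 'rV[R]_p) :
  linear f -> forall u, u *m lin1_mx f = f u.
Proof.
move=> lf u; pose fM := GRing.isLinear.Build _ _ _ _ _ lf.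
pose fL : {linear 'rV[R]_m -> 'rV[R]_p} := HB.pack f fM.
exact: (mul_rV_lin1 fL).
Qed.

Lemma endo_trE m (f : 'rV[R]_m -> 'rV[R]_m) :
  endo_tr f = \sum_j f (delta_mx 0 j) 0 j.
Proof. by apply: eq_bigr => j _; rewrite mxE. Qed.

Lemma endo_trD m (f h : 'rV[R]_m -> 'rV[R]_m) :
  endo_tr (fun w => f w + h w) = endo_tr f + endo_tr h.
Proof. by rewrite !endo_trE -big_split; apply: eq_bigr => j _; rewrite !mxE. Qed.

Lemma endo_trZ m c (f : 'rV[R]_m -> 'rV[R]_m) :
  endo_tr (fun w => c *: f w) = c * endo_tr f.
Proof. by rewrite !endo_trE mulr_sumr; apply: eq_bigr => j _; rewrite !mxE. Qed.

Lemma endo_trN m (f : 'rV[R]_m -> 'rV[R]_m) :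
  endo_tr (fun w => - f w) = - endo_tr f.
Proof. by rewrite !endo_trE -sumrN; apply: eq_bigr => j _; rewrite !mxE. Qed.

Lemma endo_tr_id m : endo_tr (fun w : 'rV[R]_m => w) = m%:R.
Proof.
rewrite endo_trE (eq_bigr (fun=> 1)) ?sumr_const ?card_ord// => j _.
by rewrite mxE !eqxx.
Qed.

Lemma endo_trC m (f h : 'rV[R]_m -> 'rV[R]_m) : linear f -> linear h ->
  endo_tr (fun w => f (h w)) = endo_tr (fun w => h (f w)).
Proof.
move=> lf lh; have lin1_comp (p q : 'rV[R]_m -> 'rV[R]_m) : linear p ->
    lin1_mx (fun w => p (q w)) = lin1_mx q *m lin1_mx p.
  have delta_lin1 i (l : 'rV[R]_m -> 'rV[R]_m) :
      delta_mx 0 i *m lin1_mx l = l (delta_mx 0 i).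
    by apply/rowP => j; rewrite -rowE !mxE.
  move=> lp; apply/row_matrixP => i.
  by rewrite row_mul !rowE !delta_lin1 mul_lin1_mx.
by rewrite /endo_tr lin1_comp// mxtrace_mulC -lin1_comp.
Qed.

Lemma endo_tr_block m (f : 'rV[R]_(m + m) -> 'rV[R]_(m + m)) :
  endo_tr f = endo_tr (fun u => lsubmx (f (row_mx u 0)))
            + endo_tr (fun u => rsubmx (f (row_mx 0 u))).
Proof.
rewrite !endo_trE big_split_ord /=; congr (_ + _); apply: eq_bigr => j _.
  rewrite mxE; congr (f _ 0 _); apply/rowP => i; rewrite !mxE eqxx /=.
  by case: (split_ordP i) => i' ->; rewrite ?mxE ?eqxx /= ?eq_lshift ?eq_rlshift.
rewrite mxE; congr (f _ 0 _); apply/rowP => i; rewrite !mxE eqxx /=.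
by case: (split_ordP i) => i' ->; rewrite ?mxE ?eqxx /= ?eq_rshift ?eq_lrshift.
Qed.

Definition posdef m (B : 'M[R]_m) :=
  B^T = B /\ forall v, v != 0 -> 0 < bform B v v.

Lemma posdef_unit m (B : 'M[R]_m) : posdef B -> B \in unitmx.
Proof.
move=> [_ Bpos]; rewrite -row_free_unit; apply: inj_row_free => v vB.
apply/eqP; apply: contraT => /Bpos; rewrite /bform vB mul0mx mxE ltxx.
by [].
Qed.

(** If [A] is the matrix of [f], skewness says [A = - B A^T B^-1], so [A] has the
    same trace as [- A^T]. This is how connection coefficients are compared: two
    endomorphisms with the same [B]-symmetric part have the same trace. *)
Lemma endo_tr_skew m (B : 'M[R]_m) (f : 'rV[R]_m -> 'rV[R]_m) :
  posdef B -> linear f -> (forall a b, bform B (f a) b + bform B a (f b) = 0) ->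
  endo_tr f = 0.
Proof.
move=> Bpos lf fskew; have Bu := posdef_unit Bpos.
have : lin1_mx f *m B + B *m (lin1_mx f)^T = 0.
  apply/matrixP => i j; rewrite bform_delta bformDm.
  rewrite [RHS]mxE -(fskew (delta_mx 0 i) (delta_mx 0 j)).
  by rewrite -!(mul_lin1_mx lf) /bform [(_ *m lin1_mx f)^T]trmx_mul !mulmxA.
move=> /(congr1 (fun C => \tr (C *m invmx B))).
rewrite mulmxDl mul0mx mxtrace0 mxtraceD mulmxK//.
rewrite mxtrace_mulC mulmxA mulVmx// mul1mx mxtrace_tr -/(endo_tr f).
by move=> /eqP; rewrite -mulr2n mulrn_eq0 /= => /eqP.
Qed.

(** The expansion of every vector says that [B] is the inverse of
    [P = \sum_a (e a)^T (e a) + N^T N], so the left-hand side is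
    [\tr (A B P) = \tr A]. *)
Lemma trace_orthonormal m (A B : 'M[R]_m) k (e : 'I_k -> 'rV[R]_m) (N : 'rV[R]_m) :
  (forall w, w = \sum_a bform B w (e a) *: e a + bform B w N *: N) ->
  \sum_a bform B (e a *m A) (e a) + bform B (N *m A) N = \tr A.
Proof.
move=> expand; pose P := \sum_a (e a)^T *m e a + N^T *m N.
have bformZ w v : bform B w v *: v = w *m (B *m (v^T *m v)).
  rewrite !mulmxA -[in RHS](mulmxA (w *m B)).
  by rewrite mulmxA [w *m B *m v^T]mx11_scalar mul_scalar_mx.
have BP : B *m P = 1%:M.
  apply/row_matrixP => i; rewrite row1 rowE [RHS](expand (delta_mx 0 i)).
  rewrite /P mulmxDr mulmx_sumr mulmxDr mulmx_sumr bformZ; congr (_ + _).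
  by apply: eq_bigr => a _; rewrite bformZ.
have trb v : bform B (v *m A) v = \tr (A *m (B *m (v^T *m v))).
  by rewrite /bform -trace_mx11 -!mulmxA mxtrace_mulC -!mulmxA.
rewrite -[in RHS](mulmx1 A) -BP /P mulmxDr mulmx_sumr mulmxDr mulmx_sumr.
rewrite mxtraceD raddf_sum /= trb; congr (_ + _).
by apply: eq_bigr => a _; rewrite trb.
Qed.

(** Gram-Schmidt, as an induction on the rank: split off a unit vector [u] of [U]
    and continue with the orthogonal complement of [u] in [U]. *)
Lemma orthonormal_span m (B : 'M[R]_m) (U : 'M[R]_m) : posdef B ->
  exists k (e : 'I_k -> 'rV[R]_m),
    (forall a b, bform B (e a) (e b) = (a == b)%:R) /\
    (forall w, (w <= U)%MS <-> exists t : 'I_k -> R, w = \sum_a t a *: e a).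
Proof.
move=> [Bs Bpos]; have [d] := ubnP (\rank U); elim: d U => // d IH U rU.
have [U0|U0] := eqVneq U 0.
  exists 0%N, (fun=> 0); split=> [[]//|w]; rewrite U0 submx0.
  split=> [/eqP->|[t ->]]; last by rewrite big_ord0.
  by exists (fun=> 0); rewrite big_ord0.
pose v := nz_row U; have v0 : v != 0 by rewrite nz_row_eq0.
pose u := (Num.sqrt (bform B v v))^-1 *: v.
have uu : bform B u u = 1.
  rewrite !bformE mulrA -invfM -expr2 sqr_sqrtr ?ltW ?Bpos// mulVf//.
  by rewrite gt_eqF// Bpos.
have uU : (u <= U)%MS by rewrite scalemx_sub// nz_row_sub.
clearbody u.
pose U' := (U :&: kermx (B *m u^T))%MS.
have inU' w : (w <= U')%MS = (w <= U)%MS && (bform B w u == 0).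
  rewrite sub_capmx; congr (_ && _); apply/sub_kermxP/eqP.
    by rewrite mulmxA /bform => ->; rewrite mxE.
  by move=> wu; rewrite mulmxA [LHS]mx11_scalar -/(bform B w u) wu raddf0.
have rU' : (\rank U' < d)%N.
  move: rU; rewrite ltnS; apply: leq_trans; apply: rank_ltmx; rewrite ltmxE capmxSl /=.
  by apply/negP => /(submx_trans uU); rewrite inU' uU uu oner_eq0.
have [k [e [eo eU']]] := IH U' rU'.
have eU a : (e a <= U')%MS.
  apply/eU'; exists (fun b => (b == a)%:R).
  by rewrite (bigD1 a)//= eqxx scale1r big1 ?addr0// => b /negbTE->; rewrite scale0r.
have eu a : bform B (e a) u = 0.
  by have := eU a; rewrite inU' => /andP[_ /eqP].
exists k.+1, (fun a => if unlift ord0 a is Some b then e b else u); split.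
  move=> a b; case: (unliftP ord0 a) => [a'|] ->; case: (unliftP ord0 b) => [b'|] ->;
    rewrite ?liftK ?unlift_none.
  - by rewrite eo (inj_eq lift_inj).
  - by rewrite eu.
  - by rewrite bform_sym// eu.
  - by rewrite uu.
move=> w; split.
  move=> wU; have /eU' [t tE] : (w - bform B w u *: u <= U')%MS.
    rewrite inU' addmx_sub ?eqmx_opp ?scalemx_sub//=.
    by rewrite !bformE uu mulr1 subrr.
  exists (fun a => if unlift ord0 a is Some b then t b else bform B w u).
  rewrite big_ord_recl !unlift_none -[LHS](subrK (bform B w u *: u)) tE addrC.
  by congr (_ + _); apply: eq_bigr => a _; rewrite !liftK.
move=> [t ->]; rewrite big_ord_recl unlift_none addmx_sub ?scalemx_sub//.
apply: summx_sub => a _; rewrite liftK scalemx_sub//.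
by have := eU a; rewrite inU' => /andP[].
Qed.

End LinearAlgebra.

(** * Mean curvature of a level set *)

Section Curves.
Context {R : realType} {V W : normedModType R}.

Lemma is_derive_curve (f : V -> W) (c : R -> V) (a : V) :
  differentiable f (c 0) -> is_derive (0 : R) 1 c a ->
  is_derive (0 : R) 1 (fun t => f (c t)) ('D_a f (c 0)).
Proof.
move=> df [c0 <-]; have dc : differentiable c 0 by exact/derivable1_diffP.
have dfc : differentiable (f \o c) 0 by exact: differentiable_comp.
apply: DeriveDef; first exact/derivable1_diffP.
by rewrite [LHS]deriveE// diff_comp//= (deriveE _ dc) deriveE.
Qed.

Lemma is_derive_derive1 (c : R -> V) (t : R) (a : V) :
  derivable c t 1 -> derive1 c t = a -> is_derive t 1 c a.
Proof. by move=> ct <-; apply: DeriveDef => //; rewrite -derive1E. Qed.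

Lemma derive_is_linear (f : V -> W) x : differentiable f x -> linear (fun v => 'D_v f x).
Proof. by move=> df c u v; rewrite !deriveE// linearP. Qed.

Lemma is_derive_uniq (f : V -> W) x v d1 d2 :
  is_derive x v f d1 -> is_derive x v f d2 -> d1 = d2.
Proof. by move=> [_ <-] [_ <-]. Qed.

End Curves.

Section MetricCompatibility.
Context {R : realType} {n : nat}.

Lemma is_derive_bform_cst (g : 'rV[R]_n -> 'M[R]_n) x u v w dg :
  is_derive x u g dg -> is_derive x u (fun y => bform (g y) v w) (bform dg v w).
Proof.
move=> dgx.
apply: (is_derive_eq (is_derive_bform dgx (is_derive_cst v x u) (is_derive_cst w x u))).
by rewrite bform0l bform0r !addr0.
Qed.

Lemma nabla_metricE (G : 'rV[R]_n -> 'I_n -> 'M[R]_n) (g : 'rV[R]_n -> 'M[R]_n) x u v w :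
  derivable g x u ->
  nabla_metric G g x u v w = bform ('D_u g x) v w
    - bform (g x) (bmap (G x) u v) w - bform (g x) v (bmap (G x) u w).
Proof.
move=> gx; rewrite /nabla_metric /cov_deriv !derive_cst !add0r; congr (_ - _ - _).
by have [_ <-] := is_derive_bform_cst v w (derivableP gx).
Qed.

End MetricCompatibility.

Lemma ipE {R : realType} {n} (g : 'rV[R]_n -> 'M[R]_n) x v w :
  ip g x v w = bform (g x) v w.
Proof. by []. Qed.

Lemma christoffelE {R : realType} {n} (G : 'rV[R]_n -> 'I_n -> 'M[R]_n) x v w :
  christoffel G x v w = bmap (G x) v w.
Proof. by []. Qed.

Lemma bform_suml {R : realType} {n} (B : 'M[R]_n) (I : Type) (s : seq I)
    (v : I -> 'rV[R]_n) w :
  bform B (\sum_(a <- s) v a) w = \sum_(a <- s) bform B (v a) w.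
Proof. by rewrite /bform !mulmx_suml summxE. Qed.

Section LevelSet.
Context {R : realType} {m : nat} (A : atlas R m).
Variables (g : metric_data A) (G : connection_data A) (S : set (pt A)).
Variables (i : chart A) (z : 'rV[R]_m).
Variables (F : 'rV[R]_m -> R) (V : 'rV[R]_m -> 'rV[R]_m).
Hypothesis zdom : chart_dom i z.
Hypothesis zS : S (chart_par i z).
Hypothesis dg : differentiable (g i) z.
Hypothesis gpos : posdef (g i z).
Hypothesis Gg : forall u v w, nabla_metric (G i) (g i) z u v w = 0.
Hypothesis dV : differentiable V z.
Hypothesis V0 : V z != 0.
Hypothesis gradF : forall y b, chart_dom i y -> bform (g i y) (V y) b = 'D_b F y.
Hypothesis tangentF : forall y, chart_dom i y -> S (chart_par i y) ->
  tangent_space S i y = [set w | 'D_w F y = 0].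
Hypothesis extend : forall b, 'D_b F z = 0 -> exists Y, tangent_extension S i z b Y.

Let L a := cov_deriv (G i) a V z.

Lemma metric_compat u v w :
  bform ('D_u (g i) z) v w =
  bform (g i z) (bmap (G i z) u v) w + bform (g i z) v (bmap (G i z) u w).
Proof.
have := Gg u v w; rewrite nabla_metricE; last exact: diff_derivable.
by move=> /eqP; rewrite -addrA -opprD subr_eq0 => /eqP.
Qed.

(** The function [y |-> g (V y, Y y)] vanishes on [S], because [V] is the gradient
    of [F] and [Y] is tangent. Differentiating it along a curve of [S] with
    velocity [a] expresses the normal part of [nabla_a Y] through [nabla_a V],
    which shows at once that it depends on [Y] only through [Y z = b]. *)
Lemma second_form_level c a b : 'D_a F z = 0 -> 'D_b F z = 0 ->
  second_form g G S i z (c *: V z) a b = - (c * bform (g i z) (L a) b).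
Proof.
move=> aF bF; suff ext Y : tangent_extension S i z b Y ->
    ip (g i) z (cov_deriv (G i) a Y z) (c *: V z) = - (c * bform (g i z) (L a) b).
  have [Y bY] := extend bF; apply: xget_unique; first by exists Y; rewrite ext.
  by move=> s [Y' [bY' ->]]; rewrite ext.
move=> [Yz [D [oD Dz Ddom Ysmooth Ytan]]].
have : tangent_space S i z a by rewrite tangentF.
move=> [cu [cu0 cu1 cua ncu]].
have dc : is_derive (0 : R) 1 cu a by exact: is_derive_derive1.
have dY : differentiable Y z := (Ck_on_differentiable (Ysmooth 1%N) Dz).
have E := is_derive_bform (is_derive_curve (f := g i) (c := cu) (a := a) _ dc)
  (is_derive_curve (f := V) (c := cu) (a := a) _ dc)
  (is_derive_curve (f := Y) (c := cu) (a := a) _ dc).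
rewrite !cu0 in E; have {}E := E dg dV dY.
have : is_derive (0 : R) 1 (fun t => bform (g i (cu t)) (V (cu t)) (Y (cu t))) 0.
  apply: (@near_eq_is_derive _ _ _ (cst 0)).
  have cD : \forall t \near (0 : R), D (cu t).
    have : {for 0, continuous cu} by exact/differentiable_continuous/derivable1_diffP.
    by apply; apply: open_nbhs_nbhs; rewrite cu0.
  apply: filterS2 ncu cD => t [ct St] Dt.
  rewrite gradF//; have := Ytan _ Dt St.
  by rewrite tangentF.
move=> /(is_derive_uniq E); rewrite Yz metric_compat.
rewrite ipE /L /cov_deriv !christoffelE Yz !bformE => D0; rewrite -mulrN; congr (_ * _).
rewrite (bform_sym _ (V z) gpos.1) (bform_sym (bmap _ _ _) (V z) gpos.1).
by move: D0; lra.
Qed.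

Let LE a : L a = 'D_a V z + bmap (G i z) a (V z).
Proof. by []. Qed.

Let L_linear : linear L.
Proof.
move=> c u v; rewrite !LE (derive_is_linear dV) bmapDl bmapZl scalerDr.
by rewrite addrACA.
Qed.

(** An orthonormal basis of the tangent space becomes one of the whole space when
    the unit normal is added, so the trace of the covariant derivative of [V]
    over the tangent space is its full trace, the divergence of [V], minus the
    normal contribution. *)
Lemma mean_curvature_level :
  let s := Num.sqrt (bform (g i z) (V z) (V z)) in
  mean_curvature g G S i z (s^-1 *: V z) =
  - (s^-1 * (endo_tr (fun a => cov_deriv (G i) a V z)
             - (bform (g i z) (V z) (V z))^-1 *
               bform (g i z) (cov_deriv (G i) (V z) V z) (V z))).
Proof.
set q := bform _ (V z) (V z) => s.
have [N NE] : exists N, N = s^-1 *: V z by eexists.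
have q0 : 0 < q by exact: gpos.2.
have s0 : s != 0 by rewrite sqrtr_eq0 -ltNge.
have ss : s^-1 * s^-1 = q^-1 by rewrite -invfM -expr2 sqr_sqrtr ?ltW.
have NN : bform (g i z) N N = 1 by rewrite NE !bformE mulrA ss mulVf// gt_eqF.
have FN w : 'D_w F z = s * bform (g i z) w N.
  by rewrite -gradF// NE bformZr mulrA mulfV// mul1r bform_sym// gpos.1.
have tanN : tangent_space S i z = [set w | bform (g i z) w N = 0].
  rewrite tangentF//; apply/seteqP; split=> w /=; rewrite FN.
    by move/eqP; rewrite mulf_eq0 (negbTE s0) => /eqP.
  by move->; rewrite mulr0.
have trace k (e : 'I_k -> 'rV[R]_m) : orthonormal_basis g S i z e ->
    \sum_a second_form g G S i z N (e a) (e a) =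
    - (s^-1 * (endo_tr L - q^-1 * bform (g i z) (L (V z)) (V z))).
  rewrite /orthonormal_basis tanN => -[eo espan].
  have eN a : bform (g i z) (e a) N = 0.
    suff : [set w | bform (g i z) w N = 0] (e a) by [].
    rewrite espan; exists (fun b => (b == a)%:R).
    by rewrite (bigD1 a)//= eqxx scale1r big1 ?addr0// => b /negbTE->; rewrite scale0r.
  rewrite (eq_bigr (fun a => - (s^-1 * bform (g i z) (L (e a)) (e a)))); last first.
    by move=> a _; rewrite [in LHS]NE second_form_level// FN eN mulr0.
  rewrite sumrN -mulr_sumr; congr (- (_ * _)).
  have expand w : w = \sum_a bform (g i z) w (e a) *: e a + bform (g i z) w N *: N.
    have : [set v | bform (g i z) v N = 0] (w - bform (g i z) w N *: N).
      by rewrite /= !bformE NN mulr1 subrr.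
    rewrite espan => -[t wt]; rewrite -[LHS](subrK (bform (g i z) w N *: N)) wt.
    congr (_ + _); apply: eq_bigr => a _; congr (_ *: _).
    have := congr1 (bform (g i z) ^~ (e a)) wt.
    rewrite !bformE (bform_sym N _ gpos.1) eN mulr0 oppr0 addr0 => ->.
    rewrite bform_suml (bigD1 a)//= big1 ?addr0.
      by rewrite bformZl -ipE eo eqxx mulr1.
    by move=> b /negbTE ba; rewrite bformZl -ipE eo ba mulr0.
  have := trace_orthonormal (lin1_mx L) expand.
  rewrite -/(endo_tr L) => <-.
  rewrite NE -scalemxAl bformZl bformZr mulrA ss mul_lin1_mx// addrK.
  by apply: eq_bigr => a _; rewrite mul_lin1_mx.
rewrite -NE; apply: xget_unique; last by move=> H [k [e [/trace <- ->]]].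
have [k [e [eo espan]]] := orthonormal_span (kermx (g i z *m N^T)) gpos.
suff onb : orthonormal_basis g S i z e by exists k, e; split=> //; rewrite trace.
split=> //; rewrite tanN; apply/seteqP; split=> w /=.
  by move=> wN; apply/espan/sub_kermxP; rewrite mulmxA [LHS]mx11_scalar
    -/(bform (g i z) w N) wN raddf0.
by move=> /espan/sub_kermxP; rewrite mulmxA /bform => ->; rewrite mxE.
Qed.

End LevelSet.

(** * Lifts and the Sasakian metric in a chart *)

Section Lifts.
Context {R : realType} {n : nat} (M : atlas R n).
Variables (g : metric_data M) (G : connection_data M).

Lemma vliftE (x v u : 'rV[R]_n) : vlift x v u = row_mx 0 u.
Proof.
rewrite /vlift derive1E; apply: derive_val; apply: is_derive_row_mx.
exact: is_derive_line.
Qed.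

(** At time [0] the base curve has velocity [u] and the equation of parallel
    transport prescribes the velocity [- Gamma (u, v)] of the fibre vector. *)
Lemma is_hliftE i x v u a : is_hlift G i x v u a ->
  a = row_mx u (- christoffel (G i) x u v).
Proof.
move=> [c [xi [c0 c1 xi0 near0 ->]]].
have [_ dc _ dxi [_ par]] := nbhs_singleton near0.
rewrite derive1E; apply: derive_val; apply: is_derive_row_mx.
  exact: (is_derive_derive1 dc c1).
apply: (is_derive_derive1 dxi); apply/eqP.
by move/eqP : par; rewrite /cov_along c0 c1 xi0 addr_eq0.
Qed.

(** The existence of the lift, which in general requires solving the geodesic
    equation, is forced by the Sasakian metric: without a lift [hlift] would take
    its default value [0], and the lift of [u] would not have the length of [u]
    unless [u = 0]. *)
Lemma hliftE (gt : metric_data (TM M)) i x v u :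
  is_metric g -> is_sasakian g G gt -> chart_dom i x ->
  hlift G i x v u = row_mx u (- christoffel (G i) x u v).
Proof.
move=> gM [gtM gtS] ix; have [] := pselect (exists a, is_hlift G i x v u a).
  by move=> [a ua]; apply: is_hliftE; exact: (xgetI _ ua).
move=> nex; have h0 : hlift G i x v u = 0.
  by apply: xgetPN => a ua; apply: nex; exists a.
suff u0 : u = 0 by rewrite h0 u0 christoffelE bmap0l oppr0 row_mx0.
have [_ + _] := gtS i x v u u ix; rewrite h0 !ipE bform0l => gu.
apply/eqP; apply: contraT => u0; have [_ _ gpos _] := gM.
by have := gpos i x u ix u0; rewrite ipE -gu ltxx.
Qed.

End Lifts.

Section Sasaki.
Context {R : realType} {n : nat} (M : atlas R n).
Variables (g : metric_data M) (G : connection_data M) (gt : metric_data (TM M)).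
Hypotheses (gM : is_metric g) (gtS : is_sasakian g G gt).

(** The vertical component for the splitting defined by the connection, not the
    fibre coordinates of [a]: it vanishes on horizontal lifts. *)
Definition vert (i : chart M) (y : 'rV[R]_(n + n)) (a : 'rV[R]_(n + n)) : 'rV[R]_n :=
  rsubmx a + bmap (G i (lsubmx y)) (lsubmx a) (rsubmx y).

(** Every vector is the sum of the horizontal lift of its base component and the
    vertical lift of its vertical component, and the two kinds are orthogonal. *)
Lemma sasakianE (i : chart M) (y a b : 'rV[R]_(n + n)) : chart_dom i (lsubmx y) ->
  bform (gt i y) a b = bform (g i (lsubmx y)) (lsubmx a) (lsubmx b)
    + bform (g i (lsubmx y)) (vert i y a) (vert i y b).
Proof.
move=> iy; have [[_ gtsym _ _] gtS2] := gtS.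
set x := lsubmx y in iy *; set v := rsubmx y.
have split_lift c : c = hlift G i x v (lsubmx c) + vlift x v (vert i y c).
  rewrite (hliftE _ _ gM gtS iy) vliftE add_row_mx addr0 /vert christoffelE.
  by rewrite addrC addrK hsubmxK.
rewrite [in LHS](split_lift a) [in LHS](split_lift b) [LHS]bformDl.
rewrite (bformDr _ (hlift _ _ _ _ _)) (bformDr _ (vlift _ _ _)).
have yE : row_mx x v = y by exact: hsubmxK.
clearbody x v; subst y.
have vh u w : bform (gt i (row_mx x v)) (vlift x v u) (hlift G i x v w) = 0.
  by have [_ _] := gtS2 i x v u w iy.
have hv u w : bform (gt i (row_mx x v)) (hlift G i x v w) (vlift x v u) = 0.
  by rewrite bform_sym ?vh//; apply: gtsym; rewrite /= row_mxKl.
have vv u w : bform (gt i (row_mx x v)) (vlift x v u) (vlift x v w) =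
    bform (g i x) u w by have [] := gtS2 i x v u w iy.
have hh u w : bform (gt i (row_mx x v)) (hlift G i x v u) (hlift G i x v w) =
    bform (g i x) u w by have [] := gtS2 i x v u w iy.
by rewrite vv hh vh hv addr0 add0r.
Qed.

End Sasaki.

(** * The sphere bundle in a chart *)

Section SphereBundle.
Context {R : realType} {n : nat} (M : atlas R n).
Variables (g : metric_data M) (r : R) (i : chart M).
Hypotheses (hM : is_manifold M) (gM : is_metric g) (r0 : 0 < r).

Notation TMi := (i : chart (TM M)).
Notation dom := [set y : 'rV[R]_(n + n) | chart_dom i (lsubmx y)].
Notation S := (sphere_bundle g r).

Lemma open_dom : open dom.
Proof.
have [oi _ _ _ _] := hM.
by apply: open_comp (oi i) => y _; exact: continuous_lsubmx.
Qed.

Definition sqnorm (y : 'rV[R]_(n + n)) : R :=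
  bform (g i (lsubmx y)) (rsubmx y) (rsubmx y).

(** A point of the sphere bundle may be given in another chart [j]; its components
    there are obtained with the transition map, which preserves the metric. *)
Lemma sphere_bundleE y : dom y -> S (chart_par TMi y) <-> sqnorm y = r ^+ 2.
Proof.
move=> iy; have [oi coordK _ _ _] := hM; have [_ _ _ gtrans] := gM; split; last first.
  by move=> yr; exists i, (lsubmx y), (rsubmx y); rewrite hsubmxK.
move=> [j [x [v [jx xv [px]]]]].
rewrite row_mxKl row_mxKr in px * => /(congr1 (fun f => f j)).
have imj : chart_image j (chart_par j x) by exists x.
rewrite px !(asboolT imj).
have tx : transition i j (lsubmx y) = x by rewrite /transition px coordK.
have -> : 'D_v (transition j j) x = v.
  rewrite (near_eq_derive (g := id)) ?derive_id//.
  by apply: filterS (open_nbhs_nbhs (conj (oi j) jx)) => x'; exact: coordK.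
move=> dy; rewrite -xv /sqnorm -ipE (gtrans i j); last by split; rewrite // px.
by rewrite tx dy.
Qed.

Lemma Ck_on_metric k : Ck_on k dom (fun y : 'rV[R]_(n + n) => g i (lsubmx y)).
Proof.
have [gsmooth _ _ _] := gM.
exact: (@Ck_on_complin _ _ _ _ _ lsubmx _ _ (@differentiable_lsubmx _ _ _ _) (gsmooth i k)).
Qed.

Lemma smooth_sqnorm : smooth_on dom sqnorm.
Proof.
move=> k; apply: Ck_on_bform; [exact: open_dom | exact: Ck_on_metric | |];
  exact: (@Ck_on_linear _ _ _ _ _ rsubmx (@differentiable_rsubmx _ _ _ _)).
Qed.

Lemma differentiable_sqnorm y : dom y -> differentiable sqnorm y.
Proof. exact: Ck_on_differentiable (smooth_sqnorm 1). Qed.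

Lemma derive_sqnorm y b : dom y -> 'D_b sqnorm y =
  bform ('D_(lsubmx b) (g i) (lsubmx y)) (rsubmx y) (rsubmx y)
  + 2 * bform (g i (lsubmx y)) (rsubmx y) (rsubmx b).
Proof.
move=> iy; have [gsmooth gsym _ _] := gM.
have dg := Ck_on_differentiable (gsmooth i 1%N) iy.
have rb := is_derive_linear (rsubmx : {linear 'rV[R]_(n + n) -> 'rV[R]_n}) y b.
have [_ ->] := is_derive_bform
  (@is_derive_complin _ _ _ _ lsubmx _ _ _ _ (derivableP (@diff_derivable _ _ _ _ _ (lsubmx b) dg))) rb rb.
by rewrite (bform_sym (rsubmx b) _ (gsym _ _ iy)) mulr_natl mulr2n addrA.
Qed.

Lemma derive_sqnorm_radial y : dom y ->
  'D_(row_mx 0 (rsubmx y)) sqnorm y = 2 * sqnorm y.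
Proof. by move=> iy; rewrite derive_sqnorm// row_mxKl row_mxKr derive0 /bform
  mulmx0 mul0mx mxE add0r. Qed.

(** For the converse inclusion, take the straight line [y + t w] and rescale its
    fibre component to length [r]. The scaling factor is a function of
    [sqnorm (y + t w)], which is stationary at [t = 0] when ['D_w sqnorm y = 0],
    so the rescaled curve still has velocity [w]. *)
Lemma tangent_sphere y : dom y -> sqnorm y = r ^+ 2 ->
  tangent_space S TMi y = [set w | 'D_w sqnorm y = 0].
Proof.
move=> iy yr; have dF := differentiable_sqnorm iy.
have sqnorm_curve w (cu : R -> 'rV[R]_(n + n)) : cu 0 = y -> is_derive (0 : R) 1 cu w ->
    is_derive (0 : R) 1 (fun t => sqnorm (cu t)) ('D_w sqnorm y).
  move=> cu0 cuw; rewrite -[in 'D_w _ _]cu0.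
  by apply: is_derive_curve => //; rewrite cu0.
apply/seteqP; split=> w /=.
  move=> [cu [cu0 cu1 cuw ncu]].
  apply: is_derive_uniq (sqnorm_curve _ _ cu0 (is_derive_derive1 cu1 cuw)) _.
  apply: (@near_eq_is_derive _ _ _ (cst (r ^+ 2))).
  by apply: filterS ncu => t [it /sphere_bundleE ->].
move=> Fw; pose l (t : R) := y + t *: w.
have l0 : l 0 = y by rewrite /l scale0r addr0.
have dl : is_derive (0 : R) 1 l w by exact: is_derive_line.
have dFl := sqnorm_curve _ _ l0 dl; rewrite Fw in dFl.
have Fl0 : sqnorm (l 0) = r ^+ 2 by rewrite l0.
(* the factor bringing a vector of square norm [s] to length [r] *)
pose scal (s : R) := r * (Num.sqrt s)^-1.
have r20 : 0 < r ^+ 2 by rewrite exprn_gt0.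
have scal0 : scal (r ^+ 2) = 1.
  by rewrite /scal sqrtr_sqr gtr0_norm// mulfV// gt_eqF.
have dscal : differentiable scal (r ^+ 2).
  apply/derivable1_diffP/derivableM; first exact: derivable_cst.
  apply: derivableV; first by rewrite sqrtr_eq0 -ltNge.
  by have [] := is_derive1_sqrt r20.
pose rho t := scal (sqnorm (l t)).
have rho0 : rho 0 = 1 by rewrite /rho Fl0.
have drho : is_derive (0 : R) 1 rho 0.
  have : is_derive (0 : R) 1 rho ('D_0 scal (sqnorm (l 0))).
    by apply: is_derive_curve => //; rewrite Fl0.
  by rewrite derive0.
have dlx : is_derive (0 : R) 1 (fun t => lsubmx (l t)) (lsubmx w).
  have [_ <-] := is_derive_linear (lsubmx : {linear 'rV[R]_(n + n) -> 'rV[R]_n}) (l 0) w.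
  by apply: is_derive_curve => //; exact: differentiable_lsubmx.
have dlv : is_derive (0 : R) 1 (fun t => rsubmx (l t)) (rsubmx w).
  have [_ <-] := is_derive_linear (rsubmx : {linear 'rV[R]_(n + n) -> 'rV[R]_n}) (l 0) w.
  by apply: is_derive_curve => //; exact: differentiable_rsubmx.
pose cu t := row_mx (lsubmx (l t)) (rho t *: rsubmx (l t)).
have cu0 : cu 0 = y by rewrite /cu rho0 scale1r l0 hsubmxK.
have dcu : is_derive (0 : R) 1 cu w.
  apply: (is_derive_eq (is_derive_row_mx dlx (is_derive_scale drho dlv))).
  by rewrite scale0r add0r rho0 scale1r hsubmxK.
have [dcu0 dcuw] := dcu; have [dl0 _] := dl; have [dFl0 _] := dFl.
exists cu; split; [exact: cu0 | exact: dcu0 | by rewrite derive1E |].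
have near_dom : \forall t \near (0 : R), dom (l t).
  have : {for 0, continuous l}.
    exact: (differentiable_continuous ((derivable1_diffP _ _).1 dl0)).
  by apply; apply: open_nbhs_nbhs; split; [exact: open_dom | rewrite l0].
have near_pos : \forall t \near (0 : R), 0 < sqnorm (l t).
  have : {for 0, continuous (fun t => sqnorm (l t))}.
    exact: (differentiable_continuous ((derivable1_diffP _ _).1 dFl0)).
  by move=> /cvgr_gt; apply; rewrite Fl0.
apply: filterS2 near_dom near_pos => t lt Flt.
have cut : dom (cu t) by rewrite /= row_mxKl.
split=> //; apply/sphere_bundleE => //.
rewrite /sqnorm row_mxKl row_mxKr !bformE mulrA -/(sqnorm (l t)) /rho /scal.
rewrite -expr2 exprMn exprVn sqr_sqrtr ?ltW// mulfVK// gt_eqF//.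
Qed.

(** Correct the constant field [b] by a multiple of the radial vertical field. The
    latter has derivative [2 * sqnorm], which is the constant [2 r^2] on the
    sphere bundle; dividing by this constant keeps the extension smooth. *)
Lemma tangent_extension_sphere y b : dom y -> sqnorm y = r ^+ 2 ->
  'D_b sqnorm y = 0 -> exists Y, tangent_extension S TMi y b Y.
Proof.
move=> iy yr Fb; have oU := open_dom.
pose Y y := b - ((2 * r ^+ 2)^-1 * 'D_b sqnorm y) *: row_mx 0 (rsubmx y).
exists Y; split; first by rewrite /Y Fb mulr0 scale0r subr0.
exists dom; split=> //.
  move=> k; apply: Ck_on_mx => // j l.
  rewrite (_ : (fun y0 => _) = (fun y => b j l + (- (2 * r ^+ 2)^-1 * 'D_b sqnorm y)
      * (row_mx 0 (rsubmx y) : 'rV[R]_(n + n)) j l)); last first.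
    by apply/funext => y'; rewrite /Y !mxE !mulNr.
  apply: Ck_onD => //; first exact: (Ck_on_cst _ _ (b j l : R)).
  apply: Ck_onM => //.
    apply: Ck_onM => //; first exact: (Ck_on_cst _ _ (- (2 * r ^+ 2)^-1 : R)).
    exact: Ck_on_derive (smooth_sqnorm k.+1).
  apply: Ck_on_entry => //; apply: Ck_on_row_mx => //.
    exact: (Ck_on_cst _ _ (0 : 'rV[R]_n)).
  exact: (@Ck_on_linear _ _ _ _ _ rsubmx (@differentiable_rsubmx _ _ _ _)).
move=> {iy yr Fb} y' iy /(sphere_bundleE iy) yr.
rewrite tangent_sphere//= /Y addrC -scaleNr.
rewrite (derive_is_linear (differentiable_sqnorm iy)) derive_sqnorm_radial// yr.
rewrite -[_ *: _]/(_ * _).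
by field; rewrite gt_eqF.
Qed.

End SphereBundle.

(** * The gradient of the square norm *)

Section GradientField.
Context {R : realType} {n : nat} (M : atlas R n).
Variables (g : metric_data M) (nabla nablag : connection_data M).
Variables (gt : metric_data (TM M)).
Hypothesis hstat : statistical_structure g nabla.
Hypothesis hnablag : levi_civita g nablag.
Hypothesis hgt : is_sasakian g nabla gt.
Variable i : chart M.

Notation dom := [set y : 'rV[R]_(n + n) | chart_dom i (lsubmx y)].
Notation G := (nabla i).
Notation Gg := (nablag i).
Notation "<| u , v |>_ x" := (bform (g i x) u v) (at level 0, x at level 2).

Definition Kcoef x : 'I_n -> 'M[R]_n := fun l => G x l - Gg x l.

Lemma bmap_statE x v w : bmap (G x) v w = bmap (Gg x) v w + bmap (Kcoef x) v w.
Proof.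
by apply/rowP => l; rewrite !mxE -bformDm /Kcoef addrC subrK.
Qed.

Lemma difference_tensorE x v w : difference_tensor G Gg x v w = bmap (Kcoef x) v w.
Proof. by rewrite /difference_tensor !christoffelE bmap_statE addrC addKr. Qed.

Lemma gsym x : chart_dom i x -> (g i x)^T = g i x.
Proof. by move=> ix; have [[_ gs _ _] _ _ _] := hstat; exact: gs. Qed.

Lemma differentiable_metric x : chart_dom i x -> differentiable (g i) x.
Proof.
by move=> ix; have [[gs _ _ _] _ _ _] := hstat; exact: Ck_on_differentiable (gs i 1%N) ix.
Qed.

Lemma metricE x u v w : chart_dom i x ->
  bform ('D_u (g i) x) v w = <| bmap (Gg x) u v, w |>_ x + <| v, bmap (Gg x) u w |>_ x.
Proof.
move=> ix; have [_ _ gg] := hnablag; apply: metric_compat => //.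
  exact: differentiable_metric.
by move=> *; exact: gg.
Qed.

Lemma Ksym x v w : chart_dom i x -> bmap (Kcoef x) v w = bmap (Kcoef x) w v.
Proof.
move=> ix; have [_ _ tf _] := hstat; have [_ tfg _] := hnablag.
by rewrite -!difference_tensorE /difference_tensor tf// tfg.
Qed.

Lemma Ggsym x v w : chart_dom i x -> bmap (Gg x) v w = bmap (Gg x) w v.
Proof. by move=> ix; have [_ tf _] := hnablag; exact: tf. Qed.

(** The metric derivative [(nabla_a g)(b, c)] equals
    [- g (K (a, b), c) - g (b, K (a, c))], so the Codazzi equation is one linear
    relation between these products for each ordering of the three vectors; with
    the symmetry of [K] they force [g (K (u, v), w)] to be totally symmetric. *)
Lemma K_selfadjoint x u v w : chart_dom i x ->
  <| bmap (Kcoef x) u v, w |>_ x = <| v, bmap (Kcoef x) u w |>_ x.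
Proof.
move=> ix; have [_ _ tf cod] := hstat.
have nabla_K a b c : nabla_metric G (g i) x a b c =
    - <| bmap (Kcoef x) a b, c |>_ x - <| b, bmap (Kcoef x) a c |>_ x.
  rewrite nabla_metricE; last exact/diff_derivable/differentiable_metric.
  by rewrite metricE// !bmap_statE !bformE; ring.
have := cod i x v u w ix; have := cod i x v w u ix; have := cod i x u w v ix.
rewrite !nabla_K !(Ksym w u)// !(Ksym w v)// !(Ksym v u)//.
rewrite !(bform_sym _ (bmap _ _ _) (gsym ix)).
lra.
Qed.

(** [K (xi, xi)] as a field on the tangent bundle. *)
Definition Kxx (y : 'rV[R]_(n + n)) := bmap (Kcoef (lsubmx y)) (rsubmx y) (rsubmx y).

(** This is [2 (xi^v - K (xi, xi)^h)], twice the unnormalized normal field, here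
    as a field on a full chart of the tangent bundle. [gradientE] identifies it as
    the gradient of the square norm [xi |-> g (xi, xi)]. *)
Definition gradient (y : 'rV[R]_(n + n)) : 'rV[R]_(n + n) :=
  row_mx (- 2 *: Kxx y) (2 *: (rsubmx y + bmap (G (lsubmx y)) (Kxx y) (rsubmx y))).

Lemma vert_gradient y : vert nabla i y (gradient y) = 2 *: rsubmx y.
Proof.
by rewrite /vert row_mxKl row_mxKr bmapZl scalerDr -addrA scaleNr addrN addr0.
Qed.

(** In a vertical direction the square norm has the derivative [2 g (xi, .)]. In
    the horizontal direction over [b] it has [(nabla_b g)(xi, xi)], which is
    [- 2 g (K (b, xi), xi) = - 2 g (b, K (xi, xi))]. *)
Lemma gradientE y b : dom y ->
  bform (gt i y) (gradient y) b = 'D_b (sqnorm g i) y.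
Proof.
move=> iy; have [gM _ _ _] := hstat.
rewrite (sasakianE gM hgt)// vert_gradient derive_sqnorm//.
rewrite metricE// row_mxKl /Kxx bformZl bformZl /vert bformDr bmap_statE bformDr.
rewrite K_selfadjoint// (bform_sym (bmap _ _ _) _ (gsym iy)).
by rewrite (Ksym _ (lsubmx b))//; ring.
Qed.

Lemma gradient_sqnorm y : dom y ->
  bform (gt i y) (gradient y) (gradient y) =
  4 * (sqnorm g i y + <| Kxx y, Kxx y |>_(lsubmx y)).
Proof.
move=> iy; have [gM _ _ _] := hstat.
rewrite (sasakianE gM hgt)// vert_gradient row_mxKl !bformE /sqnorm; ring.
Qed.

End GradientField.

(** * The shape operator and the mean curvature *)

Section Computation.
Context {R : realType} {n : nat} (M : atlas R n).
Variables (g : metric_data M) (nabla nablag : connection_data M).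
Variables (gt : metric_data (TM M)) (nablagt : connection_data (TM M)).
Hypothesis hM : is_manifold M.
Hypothesis hstat : statistical_structure g nabla.
Hypothesis hnablag : levi_civita g nablag.
Hypothesis hgt : is_sasakian g nabla gt.
Hypothesis hnablagt : levi_civita gt nablagt.
Variables (i : chart M) (x xi : 'rV[R]_n).
Hypothesis ix : chart_dom i x.

Notation dom := [set y : 'rV[R]_(n + n) | chart_dom i (lsubmx y)].
Notation G := (nabla i).
Notation Gg := (nablag i).
Notation Gt := (nablagt (i : chart (TM M))).
Notation "<| u , v |>" := (bform (g i x) u v) (at level 0).
Notation Kc := (Kcoef nabla nablag i).
Notation V := (gradient nabla nablag i).

Let z : 'rV[R]_(n + n) := row_mx x xi.
Let K := bmap (Kc x).
Let k := K xi xi.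
Let Gv := bmap (G x).
Let Ggv := bmap (Gg x).
Let dG u := bmap (fun l => 'D_u (G^~ l) x).
Let dK u := bmap (fun l => 'D_u (Kc^~ l) x).
Let Gtv := bmap (Gt z).

Let lz : lsubmx z = x. Proof. exact: row_mxKl. Qed.
Let rz : rsubmx z = xi. Proof. exact: row_mxKr. Qed.
Let zdom : dom z. Proof. by rewrite /= lz. Qed.

Lemma Ck_on_connection (H : connection_data M) j : is_connection H ->
  forall l, Ck_on j (chart_dom i) (fun y => H i y l).
Proof. by move=> [Hs _] l; exact: Hs. Qed.

Let open_chart : open (chart_dom i). Proof. by have [] := hM. Qed.

Lemma Ck_on_Kcoef j l : Ck_on j (chart_dom i) (Kc^~ l).
Proof.
have [_ hG _ _] := hstat; have [hGg _ _] := hnablag.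
apply: Ck_on_mx => // a b.
rewrite (_ : (fun y => _) = (fun y => G y l a b + (-1 : R) * Gg y l a b)); last first.
  by apply/funext => y; rewrite !mxE mulN1r.
apply: Ck_onD => //; first by apply: Ck_on_entry => //; exact: Ck_on_connection.
apply: Ck_onM => //; first exact: (Ck_on_cst _ _ (-1 : R)).
by apply: Ck_on_entry => //; exact: Ck_on_connection.
Qed.

Let diffG l : differentiable (G^~ l) x.
Proof.
by have [_ hG _ _] := hstat; exact: Ck_on_differentiable (Ck_on_connection 1 hG l) ix.
Qed.

Let diffK l : differentiable (Kc^~ l) x.
Proof. exact: Ck_on_differentiable (Ck_on_Kcoef 1 l) ix. Qed.

Lemma differentiable_gradient : differentiable V z.
Proof.
have oU := open_dom (i := i) hM; have [_ hG _ _] := hstat.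
have lift (W : normedModType R) (f : 'rV[R]_n -> W) :
    Ck_on 1 (chart_dom i) f -> Ck_on 1 dom (fun y => f (lsubmx y)).
  exact: (@Ck_on_complin _ _ _ _ _ lsubmx _ _ (@differentiable_lsubmx _ _ _ _)).
have rs : Ck_on 1 dom (rsubmx : 'rV[R]_(n + n) -> 'rV[R]_n).
  exact: (@Ck_on_linear _ _ _ _ _ rsubmx (@differentiable_rsubmx _ _ _ _)).
have scal c (f : 'rV[R]_(n + n) -> 'rV[R]_n) : Ck_on 1 dom f ->
    Ck_on 1 dom (fun y => c *: f y).
  move=> kf; apply: Ck_on_mx => // a b.
  rewrite (_ : (fun y => _) = (fun y => c * f y a b)); last first.
    by apply/funext => y; rewrite mxE.
  apply: Ck_onM => //; first exact: (Ck_on_cst _ _ c).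
  exact: Ck_on_entry.
have kK : Ck_on 1 dom (Kxx nabla nablag i).
  exact: (Ck_on_bmap oU (fun l => lift _ _ (Ck_on_Kcoef 1 l)) rs rs).
have kG := Ck_on_bmap oU (fun l => lift _ _ (Ck_on_connection 1 hG l)) kK rs.
have kV := Ck_on_row_mx oU (scal (- 2) _ kK) (scal 2 _ (Ck_onD oU rs kG)).
exact: Ck_on_differentiable kV zdom.
Qed.

Let derive_l a (W : normedModType R) (f : 'rV[R]_n -> W) : differentiable f x ->
  is_derive z a (fun y => f (lsubmx y)) ('D_(lsubmx a) f x).
Proof.
move=> df; apply: (@is_derive_complin _ _ _ _ lsubmx); rewrite /= lz.
exact/derivableP/diff_derivable.
Qed.

Let derive_r a : is_derive z a (rsubmx : 'rV[R]_(n + n) -> 'rV[R]_n) (rsubmx a).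
Proof. exact: (is_derive_linear (rsubmx : {linear 'rV[R]_(n + n) -> 'rV[R]_n})). Qed.

Let dKxx a := dK (lsubmx a) xi xi + 2 *: K xi (rsubmx a).

Lemma is_derive_Kxx a : is_derive z a (Kxx nabla nablag i) (dKxx a).
Proof.
have := is_derive_bmap (fun l => derive_l a (diffK l)) (derive_r a) (derive_r a).
rewrite lz rz => H; apply: (is_derive_eq H).
rewrite -addrA (Ksym hstat hnablag _ xi ix) -/K /dKxx scaler_nat mulr2n.
by rewrite -/(dK _ _ _).
Qed.

Let Kxxz : Kxx nabla nablag i z = k.
Proof. by rewrite /Kxx lz rz. Qed.

Lemma derive_gradient a : 'D_a V z =
  row_mx (- 2 *: dKxx a)
         (2 *: (rsubmx a + (dG (lsubmx a) k xi + Gv (dKxx a) xi + Gv k (rsubmx a)))).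
Proof.
apply: derive_val; apply: is_derive_row_mx.
  apply: (is_derive_eq (is_derive_scale (is_derive_cst _ _ _) (is_derive_Kxx a))).
  by rewrite scale0r add0r.
have := is_derive_bmap (fun l => derive_l a (diffG l)) (is_derive_Kxx a) (derive_r a).
rewrite lz rz Kxxz => H.
have {}H := is_derive_scale (is_derive_cst (2 : R) z a) (is_deriveD (derive_r a) H).
apply: (is_derive_eq H).
by rewrite scale0r add0r.
Qed.

Let vertz := vert nabla i z.

Let vertzE (a : 'rV[R]_(n + n)) : vertz a = rsubmx a + Gv (lsubmx a) xi.
Proof. by rewrite /vertz /vert lz rz. Qed.

Let dvert (w a : 'rV[R]_(n + n)) := dG (lsubmx w) (lsubmx a) xi + Gv (lsubmx a) (rsubmx w).

Lemma is_derive_vert w a : is_derive z w (fun y => vert nabla i y a) (dvert w a).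
Proof.
have H := is_derive_bmap (fun l => derive_l w (diffG l))
  (is_derive_cst (lsubmx a) z w) (derive_r w).
apply: (is_derive_eq (is_deriveD (is_derive_cst (rsubmx a) z w) H)).
by rewrite add0r bmap0l addr0 lz rz.
Qed.

Lemma differentiable_sasaki : differentiable (gt (i : chart (TM M))) z.
Proof.
have [[gs _ _ _] _] := hgt.
exact: Ck_on_differentiable (gs (i : chart (TM M)) 1%N) zdom.
Qed.

Lemma derive_sasaki (w a b : 'rV[R]_(n + n)) : bform ('D_w (gt i) z) a b =
  bform ('D_(lsubmx w) (g i) x) (lsubmx a) (lsubmx b)
  + bform ('D_(lsubmx w) (g i) x) (vertz a) (vertz b)
  + <| dvert w a, vertz b |> + <| vertz a, dvert w b |>.
Proof.
have [gM _ _ _] := hstat.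
have dg := derive_l w (differentiable_metric hstat ix).
have H1 := is_derive_bform dg (is_derive_cst (lsubmx a) z w) (is_derive_cst (lsubmx b) z w).
have H2 := is_derive_bform dg (is_derive_vert w a) (is_derive_vert w b).
have near_gt : {near z, (fun y => bform (g i (lsubmx y)) (lsubmx a) (lsubmx b)) +
    (fun y => bform (g i (lsubmx y)) (vert nabla i y a) (vert nabla i y b))
    =1 (fun y => bform (gt i y) a b)}.
  have := open_nbhs_nbhs (conj (open_dom (i := i) hM) zdom).
  by apply: filterS => y iy; rewrite (sasakianE gM hgt).
have E := near_eq_is_derive near_gt (is_deriveD H1 H2).
have E' := is_derive_bform_cst a b
  (derivableP (@diff_derivable _ _ _ _ _ w differentiable_sasaki)).
rewrite (is_derive_uniq E' E).
by rewrite /cst !bformE !addr0 lz !addrA.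
Qed.

Let sasaki_tensor (w a : 'rV[R]_(n + n)) := row_mx (Ggv (lsubmx w) (lsubmx a))
  (Ggv (lsubmx w) (vertz a) + dvert w a - Gv (Ggv (lsubmx w) (lsubmx a)) xi).

(** Takes the place of the formula for the divergence in terms of the volume
    density, which for the Sasakian metric is [det g]. The endomorphism [sasaki_tensor w] is explicit and satisfies
    [gt (T a, b) + gt (a, T b) = ('D_w gt) (a, b)], as the Levi-Civita connection
    does, so the two differ by a skew endomorphism. In the splitting into
    horizontal and vertical parts [sasaki_tensor w] is triangular, with the
    Christoffel endomorphism of [g] in both diagonal blocks. *)
Lemma trace_sasaki_connection (w : 'rV[R]_(n + n)) :
  endo_tr (Gtv w) = 2 * endo_tr (Ggv (lsubmx w)).
Proof.
have [gM _ _ _] := hstat; have [[gts gtsym gtpos _] _] := hgt.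
have [_ _ gtg] := hnablagt.
have gtz : posdef (gt i z).
  by split=> [|v v0]; [exact: gtsym | exact: gtpos].
have lin_vertz : linear vertz.
  move=> c u v; rewrite !vertzE !linearP; apply/rowP => l.
  by rewrite /Gv !bmapE !mxE; ring.
have lin_T : linear (sasaki_tensor w).
  move=> c u v; rewrite /sasaki_tensor /dvert lin_vertz !linearP /Gv /Ggv /dG !bmapE.
  rewrite scale_row_mx add_row_mx; congr row_mx.
  by apply/rowP => l; rewrite !mxE; ring.
have skew : endo_tr (fun a => Gtv w a - sasaki_tensor w a) = 0.
  apply: (endo_tr_skew gtz).
    move=> c u v; rewrite lin_T /Gtv bmapDr bmapZr.
    by apply/rowP => l; rewrite !mxE; ring.
  move=> a b; rewrite !bformDl !bformDr !bformNl !bformNr.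
  have -> : bform (gt i z) (Gtv w a) b = bform ('D_w (gt i) z) a b
      - bform (gt i z) a (Gtv w b).
    rewrite (metric_compat differentiable_sasaki (G := nablagt)) ?addrK//.
    by move=> *; exact: gtg.
  rewrite derive_sasaki !(sasakianE gM hgt)// -!/(vertz _) !lz.
  rewrite !vertzE !row_mxKl !row_mxKr -!vertzE !subrK !(metricE hstat hnablag)//.
  by rewrite !bformDl !bformDr; ring.
have -> : endo_tr (Gtv w) = endo_tr (sasaki_tensor w).
  by move: skew; rewrite endo_trD endo_trN => /eqP; rewrite subr_eq0 => /eqP.
rewrite endo_tr_block mulr_natl mulr2n; congr (_ + _); congr endo_tr; apply/funext => u.
  by rewrite /sasaki_tensor !row_mxKl.
rewrite /sasaki_tensor row_mxKr /dvert vertzE row_mxKl row_mxKr /Ggv /Gv /dG !bmapE.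
by rewrite subr0 !addr0.
Qed.

Let DK u := nabla_tensor Gg (difference_tensor G Gg) x u xi xi.

Lemma nabla_KE u : DK u = dK u xi xi + Ggv u k - 2 *: K (Ggv u xi) xi.
Proof.
rewrite /DK /nabla_tensor /cov_deriv !derive_cst !add0r !christoffelE !difference_tensorE.
have -> : 'D_u (fun y => difference_tensor G Gg y xi xi) x = dK u xi xi.
  rewrite (_ : (fun y => _) = (fun y => bmap (Kc y) xi xi)); last first.
    by apply/funext => y; rewrite difference_tensorE.
  have [_ ->] := is_derive_bmap (fun l => derivableP (@diff_derivable _ _ _ _ _ u (diffK l)))
    (is_derive_cst xi x u) (is_derive_cst xi x u).
  by rewrite bmap0l bmap0r !addr0.
by rewrite (Ksym hstat hnablag xi)// -addrA -opprD scaler_nat mulr2n.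
Qed.

Let L a := cov_deriv Gt a V z.

Let Ks u v : K u v = K v u. Proof. exact: (Ksym hstat hnablag _ _ ix). Qed.

(** The divergence of the gradient field, computed in its two blocks. All
    Christoffel symbols of [g] cancel or combine into the covariant derivative of
    [K], those of the statistical connection contributing their difference [K]. *)
Lemma trace_shape : endo_tr L =
  2 * n%:R - 2 * endo_tr DK + 4 * endo_tr (fun w => K xi (K xi w))
  + 2 * endo_tr (K k).
Proof.
have [_ tft _] := hnablagt.
have -> : endo_tr L = endo_tr (fun a => 'D_a V z) + endo_tr (Gtv (V z)).
  rewrite -endo_trD; congr endo_tr; apply/funext => a.
  by rewrite /L /cov_deriv tft.
rewrite trace_sasaki_connection endo_tr_block.
have -> : endo_tr (fun u => lsubmx ('D_(row_mx u 0) V z)) =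
    - 2 * endo_tr (fun u => dK u xi xi).
  rewrite -endo_trZ; congr endo_tr; apply/funext => u.
  by rewrite derive_gradient row_mxKl /dKxx row_mxKl row_mxKr /K bmap0r scaler0 addr0.
have -> : endo_tr (fun u => rsubmx ('D_(row_mx 0 u) V z)) =
    2 * (n%:R + (2 * endo_tr (fun u => Gv (K xi u) xi) + endo_tr (Gv k))).
  rewrite -(endo_tr_id n) -endo_trZ -!endo_trD -endo_trZ; congr endo_tr; apply/funext => u.
  rewrite derive_gradient row_mxKr /dKxx row_mxKl row_mxKr.
  have dG0 : dG 0 k xi = 0.
    apply/rowP => l; rewrite mxE derive0 /bform.
    by rewrite mulmx0 mul0mx !mxE.
  have dK0 : dK 0 xi xi = 0.
    apply/rowP => l; rewrite mxE derive0 /bform.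
    by rewrite mulmx0 mul0mx !mxE.
  by rewrite dG0 dK0 !add0r /Gv bmapZl.
have -> : endo_tr (Gv k) = endo_tr (Ggv k) + endo_tr (K k).
  by rewrite -endo_trD; congr endo_tr; apply/funext => u; rewrite /Gv (bmap_statE nabla nablag).
(* by cyclicity of the trace, to meet the term of the covariant derivative of [K] *)
have -> : endo_tr (fun u => Gv (K xi u) xi) =
    endo_tr (fun u => K (Ggv u xi) xi) + endo_tr (fun w => K xi (K xi w)).
  rewrite (endo_trC (f := K^~ xi) (h := Ggv^~ xi)).
  - rewrite -endo_trD; congr endo_tr; apply/funext => u.
    by rewrite /Gv (bmap_statE nabla nablag) -/K (Ks (K xi u)) (Ks u).
  - by move=> c u v; rewrite /K bmapDl bmapZl.
  - by move=> c u v; rewrite /Ggv bmapDl bmapZl.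
have -> : endo_tr (Ggv (lsubmx (V z))) = - 2 * endo_tr (Ggv k).
  rewrite -endo_trZ; congr endo_tr; apply/funext => u.
  by rewrite row_mxKl Kxxz /Ggv bmapZl.
have -> : endo_tr DK = endo_tr (fun u => dK u xi xi) + endo_tr (Ggv k)
    - 2 * endo_tr (fun u => K (Ggv u xi) xi).
  rewrite -endo_trZ -endo_trN -!endo_trD; congr endo_tr; apply/funext => u.
  by rewrite nabla_KE /Ggv (Ggsym hnablag u k ix).
ring.
Qed.

(** Since [2 gt (L V, V)] is the derivative of [gt (V, V)] along [V], it
    can be read off from [gradient_sqnorm], without the connection of [gt]. *)
Lemma shape_normal : bform (gt i z) (L (V z)) (V z) =
  2 * bform (gt i z) (V z) (V z)
  + 4 * (- 2 * <| DK k, k |> + 4 * <| k, k |> + 4 * <| K xi k, K xi k |>).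
Proof.
have [_ _ gtg] := hnablagt; have [gM _ _ _] := hstat; have [[_ gtsym _ _] _] := hgt.
have dV := derivableP (@diff_derivable _ _ _ _ _ (V z) differentiable_gradient).
have H1 := is_derive_bform
  (derivableP (@diff_derivable _ _ _ _ _ (V z) differentiable_sasaki)) dV dV.
have H2 := is_derive_bform (derive_l (V z) (differentiable_metric hstat ix))
  (is_derive_Kxx (V z)) (is_derive_Kxx (V z)).
have H3 := derivableP (@diff_derivable _ _ _ _ _ (V z)
  (differentiable_sqnorm hM gM zdom)).
have near_V : {near z, 4 *: (sqnorm g i + (fun y => bform (g i (lsubmx y))
    (Kxx nabla nablag i y) (Kxx nabla nablag i y)))
    =1 (fun y => bform (gt i y) (V y) (V y))}.
  have := open_nbhs_nbhs (conj (open_dom (i := i) hM) zdom).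
  by apply: filterS => y iy; rewrite (gradient_sqnorm nablag hstat hgt).
have H4 := near_eq_is_derive near_V (is_deriveZ 4 (is_deriveD H3 H2)).
have := is_derive_uniq H1 H4.
rewrite (metric_compat differentiable_sasaki (G := nablagt)); last by move=> *; exact: gtg.
rewrite -(gradientE hstat hnablag hgt)// Kxxz lz.
have -> : lsubmx (V z) = - 2 *: k by rewrite row_mxKl Kxxz.
have -> : dKxx (V z) = - 2 *: dK k xi xi + 4 *: (k + K xi (Ggv k xi) + K xi (K k xi)).
  rewrite /dKxx row_mxKl row_mxKr Kxxz rz; congr (_ + _).
    apply/rowP => l; rewrite !mxE deriveE// linearZ -deriveE//.
    by rewrite /bform -scalemxAr -scalemxAl mxE.
  rewrite (bmap_statE nabla nablag) -/(Ggv _ _) -/K /K bmapZr !bmapDr -/K -/k scalerA.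
  have -> : 2 * 2 = 4 :> R by ring.
  by rewrite lz addrA.
rewrite (metricE hstat hnablag)// nabla_KE /L /cov_deriv christoffelE.
rewrite !(bform_sym (V z) _ (gtsym _ _ zdom)) !(bform_sym k _ (gsym hstat ix)).
rewrite -/(Ggv _ _) /Ggv bmapZl -/Ggv -[_ *: (_ + _ : R)]/(_ * _) !bformE.
rewrite (Ks (Ggv k xi) xi) (Ks k xi) (K_selfadjoint hstat hnablag _ (K xi k))//.
rewrite -/K -/k; lra.
Qed.

Lemma mean_curvature_sphere (r : R) : 0 < r -> <| xi, xi |> = r ^+ 2 ->
  let s2 := r ^+ 2 + <| k, k |> in
  mean_curvature gt nablagt (sphere_bundle g r) (i : chart (TM M)) z
    ((Num.sqrt s2)^-1 *: (row_mx 0 xi - row_mx k (- Gv k xi))) =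
  (Num.sqrt s2)^-1 * (- n%:R - endo_tr (K k) + endo_tr DK
    - 2 * endo_tr (fun w => K xi (K xi w)) + 1
    + s2^-1 * (2 * <| k, k |> - <| DK k, k |> + 2 * <| K xi k, K xi k |>)).
Proof.
move=> r0 xir s2; have [gM _ _ _] := hstat; have [_ _ gtg] := hnablagt.
have [[_ gtsym gtpos _] _] := hgt; have [_ _ gpos _] := gM.
have kk : 0 <= <| k, k |>.
  by have [->|k0] := eqVneq k 0; [rewrite bform0l | exact/ltW/gpos].
have s20 : 0 < s2 by rewrite ltr_pwDl// exprn_gt0.
have zr : sqnorm g i z = r ^+ 2 by rewrite /sqnorm lz rz.
have VV : bform (gt i z) (V z) (V z) = 4 * s2.
  by rewrite (gradient_sqnorm nablag hstat hgt)// zr Kxxz lz.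
have sqrt_VV : Num.sqrt (bform (gt i z) (V z) (V z)) = 2 * Num.sqrt s2.
  rewrite VV sqrtrM// [X in Num.sqrt X](_ : 4 = 2 ^+ 2) ?sqrtr_sqr ?ger0_norm//.
  by ring.
have -> : (Num.sqrt s2)^-1 *: (row_mx 0 xi - row_mx k (- Gv k xi)) =
    (Num.sqrt (bform (gt i z) (V z) (V z)))^-1 *: V z.
  rewrite sqrt_VV invfM mulrC -scalerA; congr (_ *: _).
  rewrite /gradient lz rz Kxxz scale_row_mx !scalerA opp_row_mx add_row_mx.
  by rewrite add0r opprK mulrN mulVf// scaleN1r scale1r.
rewrite (@mean_curvature_level _ _ _ _ _ _ _ _ (sqnorm g i)).
- rewrite sqrt_VV -/L trace_shape shape_normal VV.
  have : Num.sqrt s2 != 0 by rewrite sqrtr_eq0 -ltNge.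
  have : s2 != 0 by rewrite gt_eqF.
  rewrite -/s2; move: (Num.sqrt s2) => S s2n0 S0.
  by field; rewrite S0 s2n0.
- exact: zdom.
- by apply/(sphere_bundleE _ hM gM).
- exact: differentiable_sasaki.
- by split=> [|v v0]; [exact: gtsym | exact: gtpos].
- by move=> *; exact: gtg.
- exact: differentiable_gradient.
- by apply: contraTneq s20 => V0; rewrite -(pmulr_rgt0 _ (ltr0n _ 4)) -VV V0 bform0l ltxx.
- by move=> y b iy; exact: (gradientE hstat hnablag hgt).
- by move=> y iy /(sphere_bundleE _ hM gM iy); exact: (tangent_sphere hM gM r0).
- by move=> b; exact: (tangent_extension_sphere hM gM r0).
Qed.

End Computation.

Theorem proposition3p4 (R : realType) (n : nat) (M : atlas R n)
    (hM : is_manifold M)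
    (g : metric_data M) (nabla : connection_data M)
    (hstat : statistical_structure g nabla)
    (nablag : connection_data M) (hnablag : levi_civita g nablag)
    (gt : metric_data (TM M)) (hgt : is_sasakian g nabla gt)
    (nablagt : connection_data (TM M)) (hnablagt : levi_civita gt nablagt)
    (r : R) (hr : 0 < r)
    (i : chart M) (x xi : 'rV[R]_n)
    (hx : chart_dom i x) (hxi : ip (g i) x xi xi = r ^+ 2) :
  let K := difference_tensor (nabla i) (nablag i) in
  let Kxixi := K x xi xi in
  let tau := fun v => endo_tr (fun w => K x v w) in
  let DK := fun u => nabla_tensor (nablag i) K x u xi xi in
  let nrm := metric_norm (g i) x in
  mean_curvature gt nablagt (sphere_bundle g r) (i : chart (TM M))
    (row_mx x xi) (sphere_normal g nabla nablag r i x xi) =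
  (Num.sqrt (r ^+ 2 + nrm Kxixi ^+ 2))^-1 *
  ( - (n%:R - 1) - tau Kxixi + nrm Kxixi ^+ 2 / r ^+ 2
    + endo_tr DK
    - (r ^+ 2 + nrm Kxixi ^+ 2)^-1 * ip (g i) x (DK Kxixi) Kxixi
    - 2 * endo_tr (fun w => K x xi (K x xi w))
    + 2 * (nrm (K x xi Kxixi) ^+ 2 / (r ^+ 2 + nrm Kxixi ^+ 2))
    + (r ^+ 2 + nrm Kxixi ^+ 2)^-1 * nrm Kxixi ^+ 2
      * (1 - (r ^+ 2)^-1 * nrm Kxixi ^+ 2)).
Proof.
move=> K Kxixi tau DK nrm; have [gM _ _ _] := hstat; have [_ _ gpos _] := gM.
have KE v w : K x v w = bmap (Kcoef nabla nablag i x) v w := difference_tensorE _ _ _ _ _ _.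
have nrm2 v : nrm v ^+ 2 = bform (g i x) v v.
  rewrite sqr_sqrtr// ipE; have [->|v0] := eqVneq v 0; first by rewrite bform0l.
  exact/ltW/gpos.
rewrite /sphere_normal -/K -/Kxixi -/nrm vliftE (hliftE _ _ gM hgt)// christoffelE.
rewrite !nrm2 /Kxixi KE.
rewrite (mean_curvature_sphere hM hstat hnablag hgt hnablagt)//.
set k := bmap _ xi xi; set s2 := r ^+ 2 + _.
have -> : endo_tr (bmap (Kcoef nabla nablag i x) k) = tau k.
  by congr endo_tr; apply/funext => w; rewrite KE.
have -> : endo_tr (fun w => bmap (Kcoef nabla nablag i x) xi
    (bmap (Kcoef nabla nablag i x) xi w)) = endo_tr (fun w => K x xi (K x xi w)).
  by congr endo_tr; apply/funext => w; rewrite !KE.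
rewrite -/(DK _) KE ipE; congr (_ * _).
(* With [k2 = <k, k>] and [s2 = r^2 + k2], the terms in [k2] of the two sides agree
   because [k2 / r^2 + k2 / s2 * (1 - k2 / r^2) = 2 k2 / s2]. *)
have r20 : r ^+ 2 != 0 by rewrite gt_eqF// exprn_gt0.
have s20 : s2 != 0.
  rewrite gt_eqF// ltr_pwDl ?exprn_gt0//; have [->|k0] := eqVneq k 0.
    by rewrite bform0l.
  exact/ltW/gpos.
move: s20; rewrite /s2; move: (r ^+ 2) r20 => r2 r20 s20.
by field; rewrite r20 s20.
Qed.
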